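(* Let $G$ be a finite group, $\omega\in Z^3(G,\mathbb{C}^\times)$ a (normalized) 3-cocycle, and $n\geq 1$. Let $\mathbf{V}=(V,X,(V_x)_{x\in X})$ be a monomial Yetter-Drinfeld module in $\mathcal{Z}(\operatorname{Vec}_G^\omega)$. Then: (a) the action of the braid group $\mathcal{B}_n$ on $\operatorname{Hom}_{\mathcal{Z}(\operatorname{Vec}_G^\omega)}(\mathbb{C},V^{\otimes n})$ is monomial, i.e. this space carries the structure of a monomial space on which $\mathcal{B}_n$ acts by a monomial representation; (b) the dimension of $\operatorname{Hom}_{\mathcal{Z}(\operatorname{Vec}_G^\omega)}(\mathbb{C},V^{\otimes n})$ is equal to the number of regular $G$-orbits under the monomial action of $G$ on $$(X^n)_e:=\{(x_1,\ldots,x_n)\in X^n : |x_1|\cdots|x_n|=e\}.$$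
   Context: Monomial spaces and representations. A monomial space is a triple $(V,X,(V_x)_{x\in X})$ with $V$ a finite dimensional complex vector space, $X$ a finite set, and $V_x\subseteq V$ one-dimensional subspaces with $V=\bigoplus_{x\in X}V_x$. A monomial representation of a group $\Gamma$ on it is a linear representation of $\Gamma$ on $V$ such that each group element permutes the subspaces $V_x$; then $\Gamma$ acts on $X$. An element $x\in X$ is regular if every element of its stabilizer acts as the identity on $V_x$; regularity depends only on the orbit, and a regular orbit is an orbit of regular elements. The category $\mathcal{Z}(\operatorname{Vec}_G^\omega)$. Let $e$ be the identity of $G$ and ${}^gh=ghg^{-1}$. A normalized 3-cocycle is a map $\omega:G\times G\times G\to\mathbb{C}^\times$ with $\omega(ab,c,d)\,\omega(a,b,cd)=\omega(a,b,c)\,\omega(a,bc,d)\,\omega(b,c,d)$ and $\omega(a,e,b)=1$. Put $$\omega(g,g';h)=\frac{\omega({}^{gg'}h,g,g')\,\omega(g,g',h)}{\omega(g,{}^{g'}h,g')},\qquad \omega(g;f,h)=\frac{\omega({}^gf,g,h)}{\omega(g,f,h)\,\omega({}^gf,{}^gh,g)}.$$ Objects are $G$-graded vector spaces $V=\bigoplus_{g\in G}V_g$ with linear maps $v\mapsto g\triangleright v$ ($g\in G$), the twisted $G$-action, such that $e\triangleright v=v$, $(gh)\triangleright v=\omega(g,h;k)\,(g\triangleright(h\triangleright v))$ for $v\in V_k$, and $g\triangleright V_h\subseteq V_{ghg^{-1}}$. Morphisms are linear maps preserving the grading and commuting with the twisted action. The tensor product is the usual tensor product with $(V\otimes W)_g=\bigoplus_{h}V_h\otimes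 W_{h^{-1}g}$ and $h\triangleright(v\otimes w)=\omega(h;g,l)\,(h\triangleright v)\otimes(h\triangleright w)$ for $v\in V_g,w\in W_l$. The associativity constraint is $a_{V,W,Z}((v\otimes w)\otimes z)=\omega(g,h,k)\,v\otimes(w\otimes z)$ for $v\in V_g,w\in W_h,z\in Z_k$, the unit object is $\mathbb{C}$ (degree $e$, trivial action), and the braiding is $c_{V,W}(v\otimes w)=(g\triangleright w)\otimes v$ for $v\in V_g$. Braid group action. $V^{\otimes n}$ is parenthesized from the left: $(\cdots(V\otimes V)\otimes\cdots)\otimes V$. The generator $\sigma_i\in\mathcal{B}_n$ ($1\le i\le n-1$) acts on $V^{\otimes n}$ by $$\sigma_i'=(a^{-1}_{V^{\otimes(i-1)},V,V}\otimes\operatorname{id})\circ\big((\operatorname{id}_{V^{\otimes(i-1)}}\otimes c_{V,V})\otimes\operatorname{id}\big)\circ(a_{V^{\otimes(i-1)},V,V}\otimes\operatorname{id}),$$ where the last $\operatorname{id}$ in each factor is on the remaining $n-i-1$ tensor factors; this defines a homomorphism $\mathcal{B}_n\to\operatorname{Aut}(V^{\otimes n})$, and $\mathcal{B}_n$ acts on $\operatorname{Hom}(\mathbb{C},V^{\otimes n})$ by post-composition. One has $\operatorname{Hom}(\mathbb{C},V^{\otimes n})=((V^{\otimes n})_e)^G$. Monomial Yetter-Drinfeld modules. A monomial Yetter-Drinfeld module is a monomial space $(V,X,(V_x)_{x\in X})$ with $V\in\mathcal{Z}(\operatorname{Vec}_G^\omega)$ such that the twisted $G$-action permutes the $V_x$'s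 and each $V_x$ is $G$-homogeneous. Then $G$ acts on $X$, and $|x|\in G$ denotes the degree of $V_x$. The twisted action of $G$ on the degree-$e$ part $(V^{\otimes n})_e=\bigoplus_{(x_1,\ldots,x_n)\in (X^n)_e}V_{x_1}\otimes\cdots\otimes V_{x_n}$ is a genuine monomial representation of $G$, with index set $(X^n)_e$ carrying the diagonal $G$-action. *)

(* Defs.v *)
From HB Require Import structures.
From mathcomp Require Import all_boot all_order all_algebra all_fingroup.
From mathcomp Require Import boolp reals complex.

Set Implicit Arguments.
Unset Strict Implicit.
Unset Printing Implicit Defensive.

Import GRing.Theory.
Local Open Scope ring_scope.
Local Open Scope complex_scope.
Local Open Scope quotient_scope.

(* The letter (i, false), with i : 'I_n.-1, is the generator sigma_(i+1), and
   (i, true) is its formal inverse. *)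
Definition braid_word (n : nat) := seq ('I_n.-1 * bool).

Definition inv_letter (n : nat) (x : 'I_n.-1 * bool) := (x.1, ~~ x.2).

Inductive braid_eq (n : nat) : braid_word n -> braid_word n -> Prop :=
| braid_eq_refl u : braid_eq u u
| braid_eq_sym u v : braid_eq u v -> braid_eq v u
| braid_eq_trans u v w : braid_eq u v -> braid_eq v w -> braid_eq u w
| braid_eq_cat u v u' v' :
    braid_eq u v -> braid_eq u' v' -> braid_eq (u ++ u') (v ++ v')
| braid_eq_cancel x : braid_eq [:: x; inv_letter x] [::]
| braid_eq_far (i j : 'I_n.-1) : (i.+1 < j)%N ->
    braid_eq [:: (i, false); (j, false)] [:: (j, false); (i, false)]
| braid_eq_near (i j : 'I_n.-1) : j = i.+1 :> nat ->
    braid_eq [:: (i, false); (j, false); (i, false)]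
             [:: (j, false); (i, false); (j, false)].

Section BraidGroup.
Variable n : nat.
Implicit Types u v w : braid_word n.

Definition braid_eqb u v : bool := `[< braid_eq u v >].

Lemma braid_eqb_refl : reflexive braid_eqb.
Proof. by move=> u; apply/asboolP/braid_eq_refl. Qed.

Lemma braid_eqb_sym : symmetric braid_eqb.
Proof. by move=> u v; apply/asboolP/asboolP; apply: braid_eq_sym. Qed.

Lemma braid_eqb_trans : transitive braid_eqb.
Proof.
by move=> v u w /asboolP uv /asboolP vw; apply/asboolP/(braid_eq_trans uv vw).
Qed.

Canonical braid_equiv :=
  EquivRel braid_eqb braid_eqb_refl braid_eqb_sym braid_eqb_trans.

Definition braid_group := {eq_quot braid_equiv}.
HB.instance Definition _ :=
  Choice.copy braid_group {eq_quot braid_equiv}.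

Definition braid_of u : braid_group := \pi_({eq_quot braid_equiv}) u.
Definition braid_rep_word (x : braid_group) : braid_word n :=
  generic_quotient.repr (x : {eq_quot braid_equiv}).

Lemma braid_rep_wordK x : braid_of (braid_rep_word x) = x.
Proof. exact: reprK. Qed.

Lemma braid_ofP u v : braid_of u = braid_of v <-> braid_eq u v.
Proof.
split; first by move=> /eqmodP /asboolP.
by move=> uv; apply/eqmodP/asboolP.
Qed.

Definition inv_word u : braid_word n := rev (map (@inv_letter n) u).

Lemma inv_letterK : involutive (@inv_letter n).
Proof. by case=> i b; rewrite /inv_letter /= negbK. Qed.

Lemma inv_word_cat u v : inv_word (u ++ v) = inv_word v ++ inv_word u.
Proof. by rewrite /inv_word map_cat rev_cat. Qed.

Lemma inv_wordK : involutive inv_word.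
Proof. by move=> u; rewrite /inv_word map_rev revK mapK //; apply: inv_letterK. Qed.

Lemma braid_eq_catr u : braid_eq (u ++ inv_word u) [::].
Proof.
elim: u => [|x u IH]; first exact: braid_eq_refl.
rewrite -cat1s inv_word_cat -catA (catA u).
apply: braid_eq_trans (braid_eq_cancel x).
rewrite -[X in braid_eq _ X]/([:: x] ++ ([::] ++ [:: inv_letter x])).
apply: braid_eq_cat; first exact: braid_eq_refl.
by apply: braid_eq_cat => //; apply: braid_eq_refl.
Qed.

Lemma braid_eq_catl u : braid_eq (inv_word u ++ u) [::].
Proof. by have := braid_eq_catr (inv_word u); rewrite inv_wordK. Qed.

Definition braid_mul (x y : braid_group) :=
  braid_of (braid_rep_word x ++ braid_rep_word y).
Definition braid_inv (x : braid_group) := braid_of (inv_word (braid_rep_word x)).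
Definition braid_one : braid_group := braid_of [::].

Lemma braid_of_cat u v : braid_of (u ++ v) = braid_mul (braid_of u) (braid_of v).
Proof.
by apply/braid_ofP; apply: braid_eq_cat; apply/braid_ofP; rewrite braid_rep_wordK.
Qed.

Lemma braid_mulA : associative braid_mul.
Proof.
move=> x y z.
rewrite -(braid_rep_wordK x) -(braid_rep_wordK y) -(braid_rep_wordK z).
by rewrite -!braid_of_cat catA.
Qed.

Lemma braid_mul1 : left_id braid_one braid_mul.
Proof. by move=> x; rewrite -(braid_rep_wordK x) -braid_of_cat. Qed.

Lemma braid_1mul : right_id braid_one braid_mul.
Proof. by move=> x; rewrite -(braid_rep_wordK x) -braid_of_cat cats0. Qed.

Lemma braid_mulV : left_inverse braid_one braid_inv braid_mul.
Proof.
move=> x; rewrite -{2}(braid_rep_wordK x) -braid_of_cat.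
exact/braid_ofP/braid_eq_catl.
Qed.

Lemma braid_Vmul : right_inverse braid_one braid_inv braid_mul.
Proof.
move=> x; rewrite -{1}(braid_rep_wordK x) -braid_of_cat.
exact/braid_ofP/braid_eq_catr.
Qed.

HB.instance Definition _ := isGroup.Build braid_group
  braid_mulA braid_mul1 braid_1mul braid_mulV braid_Vmul.

Definition braid_gen (i : 'I_n.-1) : braid_group := braid_of [:: (i, false)].

End BraidGroup.

(* Vector spaces are allowed to be subspaces U of an ambient space V, and a
   representation on U is given by endomorphisms of V that preserve U; only
   their restriction to U matters. *)
Section Monomial.
Variables (K : fieldType) (V : vectType K).

Definition monomial_space (U : {vspace V}) (X : finType) (L : X -> {vspace V}) :=
  [/\ forall x, \dim (L x) = 1%N,
      directv (\sum_(x : X) L x)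
    & (\sum_(x : X) L x)%VS = U].

Definition representation (Gamma : groupType) (U : {vspace V})
    (rho : Gamma -> 'End(V)) :=
  [/\ forall a, (rho a @: U <= U)%VS,
      {in U, forall u, rho 1%g u = u}
    & forall a b, {in U, forall u, rho (a * b)%g u = rho a (rho b u)}].

Definition permutes_lines (Gamma : Type) (rho : Gamma -> 'End(V))
    (X : finType) (L : X -> {vspace V}) :=
  forall a x, exists y, (rho a @: L x)%VS = L y.

Definition monomial_representation (Gamma : groupType) (U : {vspace V})
    (rho : Gamma -> 'End(V)) (X : finType) (L : X -> {vspace V}) :=
  [/\ monomial_space U L, representation U rho & permutes_lines rho L].

Section Regular.
Variables (Gamma : finType) (rho : Gamma -> 'End(V)).
Variables (X : finType) (L : X -> {vspace V}).

(* The induced action on X: the y such that a maps the line at x to the line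
   at y (the default value x is never used when rho permutes the lines). *)
Definition index_act (a : Gamma) (x : X) : X :=
  odflt x [pick y | (rho a @: L x)%VS == L y].

Definition index_orbit (x : X) : {set X} := [set index_act a x | a : Gamma].

Definition regular_index (x : X) : bool :=
  [forall a, (index_act a x == x) ==> (L x <= fixedSpace (rho a))%VS].

Definition index_orbits : {set {set X}} := [set index_orbit x | x : X].

Definition regular_orbits : {set {set X}} :=
  [set O in index_orbits | [forall x in O, regular_index x]].

End Regular.
End Monomial.

Section Tensor.
Variable K : fieldType.
Implicit Types V W U : vectType K.

(* V (x) W is modelled by matrices, v (x) w being the matrix of products of the
   coordinates of v and w in fixed bases of V and W. *)
Definition tensor V W : vectType K := 'M[K]_(\dim {:V}, \dim {:W}).

Definition tens V W (v : V) (w : W) : tensor V W :=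
  \matrix_(i, j) (coord (vbasis {:V}) i v * coord (vbasis {:W}) j w).

(* The linear map V (x) W -> U that maps v (x) w to b v w, for b bilinear; see
   tlift_tens. *)
Definition tlift V W U (b : V -> W -> U) : 'Hom(tensor V W, U) :=
  linfun (fun M : 'M[K]_(\dim {:V}, \dim {:W}) =>
    \sum_i \sum_j M i j *: b (vbasis {:V})`_i (vbasis {:W})`_j).

Definition tmap V W V' W' (f : 'Hom(V, V')) (g : 'Hom(W, W')) :
    'Hom(tensor V W, tensor V' W') :=
  tlift (fun v w => tens (f v) (g w)).

Definition tensv V W (A : {vspace V}) (B : {vspace W}) :
    {vspace (tensor V W)} :=
  <<[seq tens v w | v <- vbasis A, w <- vbasis B]>>%VS.

Lemma tlift_tens V W U (b : V -> W -> U) :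
    (forall w, linear (b^~ w)) -> (forall v, linear (b v)) ->
  forall v w, tlift b (tens v w) = b v w.
Proof.
move=> bl br v w.
pose Bl w0 : {linear V -> U} :=
  HB.pack (b^~ w0) (GRing.isLinear.Build _ _ _ _ (b^~ w0) (bl w0)).
pose Br v0 : {linear W -> U} :=
  HB.pack (b v0) (GRing.isLinear.Build _ _ _ _ (b v0) (br v0)).
rewrite /tlift.
set F := fun M : 'M_(_, _) => _.
have linF : linear F.
  move=> k M N; rewrite /F scaler_sumr -big_split; apply: eq_bigr => i _ /=.
  rewrite scaler_sumr -big_split; apply: eq_bigr => j _ /=.
  by rewrite !mxE scalerDl scalerA.
pose F' : {linear _ -> _} := HB.pack F (GRing.isLinear.Build _ _ _ _ F linF).
rewrite (lfunE F') /= /F.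
have blZ k u w0 : b (k *: u) w0 = k *: b u w0 by exact: (linearZZ (Bl w0)).
have brZ k u v0 : b v0 (k *: u) = k *: b v0 u by exact: (linearZZ (Br v0)).
have -> : b v w = Bl w v by [].
rewrite [in RHS](coord_vbasis (memvf v)) linear_sum /=; apply: eq_bigr => i _.
rewrite blZ -[b _ w]/(Br (vbasis {:V})`_i w).
rewrite [in RHS](coord_vbasis (memvf w)) linear_sum scaler_sumr /=.
by apply: eq_bigr => j _; rewrite brZ scalerA !mxE.
Qed.

(* A predicate closed under linear combinations defines a subspace. *)
Lemma vspace_of_linear_pred V (P : pred V) :
    P 0 -> (forall k u v, P u -> P v -> P (k *: u + v)) ->
  exists U : {vspace V}, forall u, (u \in U) = P u.
Proof.
move=> P0 PD.
pose sub d := `[< exists U : {vspace V}, \dim U = d /\ forall u, u \in U -> P u >].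
have ex_sub : exists d, sub d.
  exists 0%N; apply/asboolP; exists 0%VS; rewrite dimv0; split=> // u.
  by rewrite memv0 => /eqP->.
have bnd d : sub d -> (d <= \dim {:V})%N.
  by move=> /asboolP[U [<- _]]; apply/dimvS/subvf.
have [d /asboolP[U [dU PU]] maxd] := ex_maxnP ex_sub bnd.
exists U => u; apply/idP/idP => [/PU//|Pu].
have : sub (\dim (<[u]> + U)%VS).
  apply/asboolP; exists (<[u]> + U)%VS; split=> // v /memv_addP[x].
  by move=> /vlineP[k ->] [y yU ->]; apply: PD => //; apply: PU.
move=> /maxd; rewrite -dU => le_dim.
have /eqP eqU : U == (<[u]> + U)%VS by rewrite eqEdim addvSr /=.
suff : u \in (<[u]> + U)%VS by rewrite -eqU.
by rewrite -[u in u \in _]addr0 memv_add ?mem0v ?memv_line.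
Qed.

End Tensor.

(* The complex numbers are R[i], for R : realType the real numbers. *)
Record cocycle3 (R : realType) (G : finGroupType) := Cocycle3 {
  omega :> G -> G -> G -> R[i];
  omega_neq0 : forall a b c, omega a b c != 0;
  omega_cocycle : forall a b c d,
    omega (a * b)%g c d * omega a b (c * d)%g =
    omega a b c * omega a (b * c)%g d * omega b c d;
  omega_normalized : forall a b, omega a 1%g b = 1
}.

(* lconj g h is g h g^-1, whereas h ^ g is g^-1 h g in MathComp. *)
Definition lconj (G : finGroupType) (g h : G) : G := (g * h * g^-1)%g.

(* omega(g, g'; h) *)
Definition omega_act (R : realType) (G : finGroupType) (w : cocycle3 R G)
    (g g' h : G) : R[i] :=
  w (lconj (g * g')%g h) g g' * w g g' h / w g (lconj g' h) g'.

(* omega(g; f, h) *)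
Definition omega_tens (R : realType) (G : finGroupType) (w : cocycle3 R G)
    (g f h : G) : R[i] :=
  w (lconj g f) g h / (w g f h * w (lconj g f) (lconj g h) g).

(* The data of an object; the axioms are in is_object. *)
Record graded_module (R : realType) (G : finGroupType) := GradedModule {
  gcarrier :> vectType R[i];
  degpart : G -> {vspace gcarrier};
  twact : G -> 'End(gcarrier)
}.

Section Category.
Variables (R : realType) (G : finGroupType) (w : cocycle3 R G).
Implicit Types V W Z : graded_module R G.

Definition is_object V : Prop :=
  [/\ directv (\sum_(g : G) degpart V g) /\
        (\sum_(g : G) degpart V g)%VS = fullv,
      forall v, twact V 1%g v = v,
      forall g h k v, v \in degpart V k ->
        twact V (g * h)%g v = omega_act w g h k *: twact V g (twact V h v)
    & forall g h, (twact V g @: degpart V h <= degpart V (lconj g h))%VS].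

(* The projection onto V_g along the other homogeneous components. *)
Definition homproj V (g : G) : 'End(V) :=
  sumv_pi (\sum_(h : G) degpart V h)%VS g.

Definition unit_module : graded_module R G :=
  @GradedModule R G (R[i]^o : vectType R[i])
    (fun g => if g == 1%g then fullv else 0%VS) (fun=> \1%VF).

Definition tensor_module V W : graded_module R G :=
  @GradedModule R G (tensor V W)
    (fun g => \sum_(h : G) tensv (degpart V h) (degpart W (h^-1 * g)%g))%VS
    (fun h => tlift (fun v u => \sum_(g : G) \sum_(l : G)
       omega_tens w h g l *:
         tens (twact V h (homproj V g v)) (twact W h (homproj W l u)))).

Definition is_morphism V W (f : 'Hom(V, W)) : bool :=
  [forall g, (f @: degpart V g <= degpart W g)%VS] &&
  [forall g, (f \o twact V g == twact W g \o f)%VF].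

Lemma morphism_space V W :
  exists U : {vspace 'Hom(V, W)}, forall f, (f \in U) = is_morphism f.
Proof.
apply: vspace_of_linear_pred.
  apply/andP; split; apply/forallP => g.
    by apply/subvP => _ /memv_imgP[v _ ->]; rewrite lfunE mem0v.
  by rewrite comp_lfun0l comp_lfun0r.
move=> k f1 f2 /andP[/forallP d1 /forallP c1] /andP[/forallP d2 /forallP c2].
apply/andP; split; apply/forallP => g.
  apply/subvP => _ /memv_imgP[v vg ->]; rewrite !lfunE /=.
  rewrite memvD // ?lfunE /= ?memvZ //.
    by apply: (subvP (d1 g)); apply: memv_img.
  by apply: (subvP (d2 g)); apply: memv_img.
rewrite comp_lfunDl comp_lfunDr -comp_lfunZl -comp_lfunZr.
by rewrite (eqP (c1 g)) (eqP (c2 g)).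
Qed.

Definition Hom_Z V W : {vspace 'Hom(V, W)} := sval (cid (morphism_space V W)).

Lemma Hom_ZP V W (f : 'Hom(V, W)) : (f \in Hom_Z V W) = is_morphism f.
Proof. by rewrite /Hom_Z; case: cid. Qed.

Definition associator V W Z :
    'Hom(tensor_module (tensor_module V W) Z,
         tensor_module V (tensor_module W Z)) :=
  tlift (fun (t : tensor V W) (z : Z) =>
    tlift (fun (v : V) (u : W) =>
      \sum_(g : G) \sum_(h : G) \sum_(k : G)
        w g h k *: tens (homproj V g v) (tens (homproj W h u) (homproj Z k z)))
    t).

Definition braiding V W : 'Hom(tensor_module V W, tensor_module W V) :=
  tlift (fun (v : V) (u : W) =>
    \sum_(g : G) tens (twact W g u) (homproj V g v)).

(* The power V^(x)(m+1), parenthesized from the left. *)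
Fixpoint tpowerS V (m : nat) : graded_module R G :=
  if m is k.+1 then tensor_module (tpowerS V k) V else V.

Definition tpower V (n : nat) : graded_module R G :=
  if n is m.+1 then tpowerS V m else unit_module.

(* sigma'_(m+1) on V^(x)(m+2); for m = 0 the factor V^(x)0 is the unit object,
   which is dropped, and the associator is the identity. *)
Definition sigma_last V (m : nat) : 'End(tpowerS V m.+1) :=
  match m with
  | 0 => braiding V V
  | k.+1 => (associator (tpowerS V k) V V)^-1 \o
              tmap \1 (braiding V V) \o associator (tpowerS V k) V V
  end%VF.

(* sigma'_(i+1) on V^(x)(m+1), with 0 <= i < m. *)
Fixpoint sigmaS V (m i : nat) : 'End(tpowerS V m) :=
  match m with
  | 0 => \1%VF
  | k.+1 => if i == k then sigma_last V k else tmap (sigmaS V k i) \1%VF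
  end.

(* sigma'_(i+1) on V^(x)n, with 0 <= i < n - 1. *)
Definition sigma V (n i : nat) : 'End(tpower V n) :=
  match n with
  | 0 => \1%VF
  | m.+1 => sigmaS V m i
  end.

Definition postcomp V W (s : 'End(W)) : 'End('Hom(V, W)) :=
  linfun (fun f : 'Hom(V, W) => (s \o f)%VF).

(* V_(x_1) (x) ... (x) V_(x_n), parenthesized as V^(x)n. *)
Fixpoint tlineS V (X : Type) (L : X -> {vspace V}) (m : nat) :
    ('I_m.+1 -> X) -> {vspace (tpowerS V m)} :=
  match m with
  | 0 => fun x => L (x ord0)
  | k.+1 => fun x =>
      tensv (tlineS L (fun i : 'I_k.+1 => x (widen_ord (leqnSn k.+1) i)))
            (L (x ord_max))
  end.

Definition tline V (X : Type) (L : X -> {vspace V}) (n : nat) :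
    ('I_n -> X) -> {vspace (tpower V n)} :=
  match n with
  | 0 => fun=> fullv
  | m.+1 => fun x => tlineS L x
  end.

Record monomial_YD := MonomialYD {
  yd_module :> graded_module R G;
  yd_object : is_object yd_module;
  yd_index : finType;
  yd_line : yd_index -> {vspace yd_module};
  yd_monomial : monomial_space fullv yd_line;
  yd_permutes : permutes_lines (twact yd_module) yd_line;
  (* yd_deg x is |x| *)
  yd_deg : yd_index -> G;
  yd_homogeneous : forall x, (yd_line x <= degpart yd_module (yd_deg x))%VS
}.

Section Neutral.
Variables (V : monomial_YD) (n : nat).

Definition neutral_tuple : finType :=
  {x : n.-tuple (yd_index V) | (\prod_(i < n) yd_deg (tnth x i))%g == 1%g}.

Definition neutral_line (x : neutral_tuple) : {vspace (tpower V n)} :=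
  tline (@yd_line V) (tnth (val x)).

End Neutral.
End Category.

Arguments neutral_line {R G w} V n x.

(* Main.v *)
Require Import Defs.
From HB Require Import structures.
From mathcomp Require Import all_boot all_order all_algebra all_fingroup.
From mathcomp Require Import boolp reals complex ring.

(**
The generators act on tensors of homogeneous vectors by an explicit formula:
if [t], [v], [u] have degrees [p], [a], [b], then the braid generator of the
last two factors sends [(t (x) v) (x) u] to the scalar
[omega(p,a,b) / omega(p, aba^-1, a)] times [(t (x) (a |> u)) (x) v]
([braid_last_tens]); only the degree of the prefix [t] matters. Tensors of
homogeneous vectors span, so every identity between the operators reduces to an
identity between values of omega, and each of these is a consequence of a few
instances of the cocycle condition: the Yang-Baxter relation
([omega_braid_relation], [braid_last_relation]), the compatibility of the
generators with the twisted action ([omega_braid_tens],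
[braid_last_morphism]), and the fact that tensor products are again objects of
the category ([omega_tens_act], [tensor_object]). Generators that are far
apart commute because operators on the prefix preserve its degree
([braid_last_far]). Hence the braid group acts on the tensor power by
automorphisms in the category.

The same formulas show that twisted action and generators permute the lines
[V_(x_1) (x) ... (x) V_(x_n)] ([tlineS_twact], [tlineS_sigma]). These lines
decompose the tensor power ([tlineS_direct]), and as they are homogeneous those
of degree [e] decompose the component of degree [e], on which the scalars
[omega_act] are trivial, so that [G] acts there by a genuine monomial
representation.

The rest is a statement about a monomial representation of a finite group [G]
in characteristic zero. Let [E] be the sum of all the operators of [G]; its
image is the space of invariants. Lines in one orbit have the same image under
[E]. This image vanishes when a stabilizer acts by a nontrivial scalar, and is
a line inside the span of the orbit when it does not. So the invariants are the
direct sum of the lines [E @: L_x], one for each regular orbit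
([invariants_monomial]), which gives the dimension. An operator that commutes
with [G] commutes with [E]; if it also permutes the lines [L_x] then it
permutes the lines [E @: L_x] ([commuting_permutes_orbit_lines]), so the braid
group acts monomially on the invariants. Evaluation at [1] identifies them with
the space of morphisms from the unit object ([Hom_unit]).
*)

Set Implicit Arguments.
Unset Strict Implicit.
Unset Printing Implicit Defensive.

Import GRing.Theory.
Local Open Scope ring_scope.

(** * Direct sums of subspaces *)

Section DirectSums.
Variables (K : fieldType) (V : vectType K).

Lemma directv_sum_inj (I J : finType) (h : J -> I) (A : I -> {vspace V}) :
  injective h -> directv (\sum_i A i) -> directv (\sum_j A (h j)).
Proof.
move=> injh /directv_sum_independent dA; apply/directv_sum_independent.
move=> us usA us0 j _.
pose vs i := \sum_(k | h k == i) us k.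
have <- : vs (h j) = us j.
  by rewrite /vs (big_pred1 j) // => k /=; rewrite (inj_eq injh).
apply: dA => // [i _|]; first by apply: memv_suml => k /eqP <-; apply: usA.
by rewrite -[RHS]us0 (partition_big h predT).
Qed.

(** Grouping the summands of a direct sum keeps it direct. An inclusion is enough
    for that, and lets [B j] be a proper subspace of the group, such as its image
    under an averaging operator. *)
Lemma directv_sum_fibers (I J : finType) (d : I -> J) (A : I -> {vspace V})
    (B : J -> {vspace V}) :
  (forall j, (B j <= \sum_(i | d i == j) A i)%VS) ->
  directv (\sum_i A i) -> directv (\sum_j B j).
Proof.
move=> BA /directv_sum_independent dA; apply/directv_sum_independent.
move=> us usB us0 j _.
have ex_vs k : exists vs : I -> V,
    (forall i, vs i \in A i) /\ us k = \sum_(i | d i == k) vs i.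
  have /memv_sumP[vs vsA ->] := subvP (BA k) _ (usB k isT).
  exists (fun i => if d i == k then vs i else 0); split=> [i|].
    by case: ifP => [/vsA|] //; rewrite mem0v.
  by apply: eq_bigr => i ->.
have [vs vsP] := choice ex_vs.
rewrite (vsP j).2 big1 // => i /eqP di.
have := dA (fun i => vs (d i) i) (fun i _ => (vsP (d i)).1 i) _ i isT.
rewrite /= di; apply.
rewrite -[RHS]us0 (partition_big d predT) //=; apply: eq_bigr => k _.
by rewrite (vsP k).2; apply: eq_bigr => i' /eqP->.
Qed.

Lemma sumv_pi_direct (I : finType) (A : I -> {vspace V}) i j v :
  directv (\sum_i A i) -> v \in A i ->
  sumv_pi (\sum_i A i)%VS j v = if j == i then v else 0.
Proof.
move=> dA vA; pose us k := if k == i then v else 0.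
have usA k : us k \in A k by rewrite /us; case: eqP => [->|] //; rewrite mem0v.
have sum_us : \sum_k us k = v by rewrite -big_mkcond /= big_pred1_eq.
have vsum : v \in (\sum_k A k)%VS.
  by rewrite -sum_us; apply: memv_sumr => k _.
have := sumv_pi_sum (erefl (\sum_k A k)%VS) vsum.
have /directv_sum_unique dA' := dA; move/eqP; rewrite -[in X in _ == X]sum_us.
rewrite dA' // => [/forall_inP/(_ j isT)/eqP //|k _].
exact: memv_sum_pi.
Qed.

(** A decomposition into lines (or any subspaces) that is compatible with a
    grading recovers the homogeneous components: the components of a vector in
    the finer decomposition, grouped by degree, are its homogeneous parts, and
    these are unique. *)
Lemma component_sum_fiber (I J : finType) (d : I -> J)
    (L : I -> {vspace V}) (A : J -> {vspace V}) j :
  directv (\sum_j A j) -> (\sum_i L i)%VS = fullv ->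
  (forall i, (L i <= A (d i))%VS) ->
  A j = (\sum_(i | d i == j) L i)%VS.
Proof.
move=> /directv_sum_unique dA sumL LA; apply/eqP; rewrite eqEsubv andbC.
apply/andP; split; first by apply/subv_sumP => i /eqP <-.
apply/subvP => v vA.
have /memv_sumP[vs vsL defv] : v \in (\sum_i L i)%VS by rewrite sumL memvf.
have sum_us : \sum_k (if k == j then v else 0) = v.
  by rewrite -big_mkcond /= big_pred1_eq.
have := defv; rewrite (partition_big d predT) //= -[LHS]sum_us.
move/eqP; rewrite dA => [/forall_inP/(_ j isT)||k _]; last first.
- by apply: memv_suml => i /eqP <-; apply: (subvP (LA i)); apply: vsL.
- by move=> k _; case: eqP => [->|] //; rewrite mem0v.
rewrite eqxx => /eqP->; apply: memv_sumr => i _; exact: vsL.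
Qed.

Lemma line_sub_eq (A B : {vspace V}) :
  \dim A = 1%N -> (A <= B)%VS -> \dim B = 1%N -> A = B.
Proof. by move=> dA AB dB; apply/eqP; rewrite eqEdim AB dA dB. Qed.

Lemma dim1_line (A : {vspace V}) : \dim A = 1%N -> exists2 v, v != 0 & A = <[v]>%VS.
Proof.
move=> dA; have /subvPn[v vA v0] : ~~ (A <= 0)%VS.
  by rewrite subv0 -dimv_eq0 dA.
rewrite memv0 in v0; exists v => //.
by apply/esym/line_sub_eq; rewrite ?dim_vline ?v0 // -memvE.
Qed.

End DirectSums.

(** * Invariants of monomial representations *)

Section Invariants.
Variables (K : fieldType) (V : vectType K).
(* The orders of [Gamma] and of the stabilizers of lines must be invertible. *)
Hypothesis K0 : forall n, n.+1%:R != 0 :> K.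
Variables (Gamma : finGroupType) (rho : Gamma -> 'End(V)) (U : {vspace V}).
Variables (X : finType) (L : X -> {vspace V}).
Hypotheses (LU : monomial_space U L) (rhoU : representation U rho).
Hypothesis permL : permutes_lines rho L.

Let dimL x : \dim (L x) = 1%N. Proof. by case: LU. Qed.
Let dirL : directv (\sum_x L x). Proof. by case: LU. Qed.
Let sumL : (\sum_x L x)%VS = U. Proof. by case: LU. Qed.
Let L_U x : (L x <= U)%VS. Proof. by rewrite -sumL (sumv_sup x). Qed.

Lemma line_inj : injective L.
Proof.
move=> x y eqL; apply/eqP/negPn/negP => nxy.
have [v v0 Lv] := dim1_line (dimL x).
have /vspaceP/(_ v) := directv_sumP dirL x isT.
rewrite memv_cap memv0 (negPf v0) => /negP; apply; apply/andP; split.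
  by rewrite Lv memv_line.
have Ly : v \in L y by rewrite -eqL Lv memv_line.
apply: subvP Ly; apply: (sumv_sup y) (subvv _); by rewrite eq_sym.
Qed.

Lemma index_actP a x : (rho a @: L x)%VS = L (index_act rho L a x).
Proof.
rewrite /index_act; case: pickP => [y /eqP //|no].
by have [y Ly] := permL a x; have := no y; rewrite Ly eqxx.
Qed.

Lemma index_act_line a x y : (rho a @: L x)%VS = L y -> index_act rho L a x = y.
Proof. by rewrite index_actP => /line_inj. Qed.

Let rhoM a b v : v \in U -> rho (a * b)%g v = rho a (rho b v).
Proof. by case: rhoU => _ _ h /h. Qed.
Let rho1 v : v \in U -> rho 1%g v = v. Proof. by case: rhoU => _ h _ /h. Qed.
Let rho_U a v : v \in U -> rho a v \in U.
Proof. by case: rhoU => h _ _ vU; apply: (subvP (h a)); apply: memv_img. Qed.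

Lemma index_act1 x : index_act rho L 1%g x = x.
Proof.
apply: index_act_line; rewrite (eq_in_limg (g := \1%VF)) ?lim1g //.
by move=> v /(subvP (L_U x))/rho1 ->; rewrite lfunE.
Qed.

Lemma index_actM a b x :
  index_act rho L (a * b)%g x = index_act rho L a (index_act rho L b x).
Proof.
apply: index_act_line; rewrite -!index_actP -limg_comp.
by apply: eq_in_limg => v /(subvP (L_U x))/rhoM ->; rewrite lfunE.
Qed.

Lemma index_orbit_act a x :
  index_orbit rho L (index_act rho L a x) = index_orbit rho L x.
Proof.
apply/setP => y; apply/imsetP/imsetP => -[b _ ->].
  by exists (b * a)%g; rewrite // index_actM.
by exists (b * a^-1)%g; rewrite // -index_actM mulgKV.
Qed.

Lemma index_orbit_refl x : x \in index_orbit rho L x.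
Proof. by apply/imsetP; exists 1%g; rewrite // index_act1. Qed.

(** Up to the factor [#|Gamma|], the projection of [U] onto its invariants. *)
Definition sum_over_group : 'End(V) := \sum_a rho a.
Local Notation E := sum_over_group.

Definition invariants : {vspace V} := (U :&: \bigcap_a fixedSpace (rho a))%VS.

Lemma invariantsP v :
  reflect (v \in U /\ forall a, rho a v = v) (v \in invariants).
Proof.
rewrite memv_cap; apply: (iffP andP) => -[vU fixv]; split=> //.
  by move=> a; apply/fixedSpaceP; apply: subvP fixv; apply: bigcapv_inf.
by rewrite memvE; apply/subv_bigcapP => a _; apply/fixedSpaceP.
Qed.

Let E_rho a v : v \in U -> E (rho a v) = E v.
Proof.
move=> vU; rewrite !sum_lfunE (reindex_inj (mulIg a^-1%g)) /=.
by apply: eq_bigr => b _; rewrite -rhoM // mulgKV.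
Qed.

Let rho_E a v : v \in U -> rho a (E v) = E v.
Proof.
move=> vU; rewrite !sum_lfunE linear_sum (reindex_inj (mulgI a^-1%g)) /=.
by apply: eq_bigr => b _; rewrite -rhoM // mulKVg.
Qed.

Let E_invariants : (E @: U)%VS = invariants.
Proof.
apply/vspaceP => v; apply/memv_imgP/invariantsP => [[u uU]|[vU fixv]]; first move=> ->.
  split=> [|a]; last exact: rho_E.
  by rewrite sum_lfunE; apply: memv_suml => a _; apply: rho_U.
have G0 : #|Gamma|%:R != 0 :> K.
  by have := cardG_gt0 [set: Gamma]%G; rewrite cardsT => /prednK <-.
exists (#|Gamma|%:R^-1 *: v); first by rewrite memvZ.
rewrite linearZ /= sum_lfunE (eq_bigr (fun=> v)) // sumr_const.
by rewrite -scaler_nat scalerA mulVf ?scale1r.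
Qed.

(* Since [E] absorbs [rho a], the lines of one orbit have the same image. *)
Let E_line a x : (E @: L (index_act rho L a x) = E @: L x)%VS.
Proof.
rewrite -index_actP -limg_comp; apply: eq_in_limg => v /(subvP (L_U x)) vU.
by rewrite lfunE /= E_rho.
Qed.

(** A vector of a regular line has a nonzero orbit sum since the component of
    that sum on its own line is a positive multiple of the vector. If an element
    acts on a line by a scalar [c != 1], then reindexing the orbit sum multiplies
    it by [c], so it vanishes. *)
Let E_line_eq0 x : (E @: L x == 0)%VS = ~~ regular_index rho L x.
Proof.
have [v v0 Lv] := dim1_line (dimL x).
have vL : v \in L x by rewrite Lv memv_line.
have vU : v \in U by apply: subvP vL.
rewrite Lv limg_line -dimv_eq0 dim_vline eqb0 negbK.
apply/eqP/idP => [Ev0|]; last first.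
  case/forallPn => a; rewrite negb_imply => /andP[/eqP ax].
  have /vlineP[c cv] : rho a v \in <[v]>%VS.
    by rewrite -Lv -ax -index_actP memv_img.
  move=> nfix; have c1 : c != 1.
    apply: contraNneq nfix => c1; rewrite Lv -memvE; apply/fixedSpaceP.
    by rewrite cv c1 scale1r.
  have /eqP := E_rho a vU; rewrite cv linearZ /= -subr_eq0 -{2}[E v]scale1r.
  by rewrite -scalerBl scaler_eq0 subr_eq0 (negPf c1) => /eqP.
apply/negP => /forallP regx.
pose vs y := \sum_(a | index_act rho L a x == y) rho a v.
have : vs x = 0.
  apply: (directv_sum_independent dirL vs) => // [y _|].
    by apply: memv_suml => a /eqP<-; rewrite -index_actP memv_img.
  by rewrite -[RHS]Ev0 sum_lfunE (partition_big (index_act rho L ^~ x) predT).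
rewrite /vs (eq_bigr (fun=> v)) => [|a /(implyP (regx a))/subvP/(_ v vL)].
  have stab1 : (0 < #|[pred a | index_act rho L a x == x]|)%N.
    by apply/card_gt0P; exists 1%g; rewrite inE index_act1.
  rewrite sumr_const -scaler_nat => /eqP; rewrite scaler_eq0 (negPf v0) orbF.
  rewrite -(prednK stab1); exact/negP/K0.
by move/fixedSpaceP.
Qed.

Definition regular_orbit := {O : {set X} | O \in regular_orbits rho L}.

(** The sum is over a fiber of [index_orbit], which is [O] itself, because
    [directv_sum_fibers] then gives the independence of these lines. *)
Definition orbit_line (O : regular_orbit) : {vspace V} :=
  (E @: \sum_(x | index_orbit rho L x == val O) L x)%VS.

Let regular_orbit_refl (O : regular_orbit) :
  exists2 x, index_orbit rho L x = val O & regular_index rho L x.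
Proof.
case: O => O /=; rewrite inE => /andP[/imsetP[x _ ->] /forall_inP regO].
by exists x => //; apply: regO (index_orbit_refl x).
Qed.

Let orbit_of_regular x : regular_index rho L x ->
  exists O : regular_orbit, val O = index_orbit rho L x.
Proof.
move=> regx; suff rO : index_orbit rho L x \in regular_orbits rho L.
  by exists (exist _ (index_orbit rho L x) rO).
rewrite inE imset_f //=; apply/forall_inP => _ /imsetP[a _ ->].
by rewrite -[regular_index _ _ _]negbK -E_line_eq0 E_line E_line_eq0 negbK.
Qed.

Let orbit_lineE (O : regular_orbit) x :
  index_orbit rho L x = val O -> orbit_line O = (E @: L x)%VS.
Proof.
move=> xO; rewrite /orbit_line limg_sum; apply/eqP; rewrite eqEsubv.
apply/andP; split; last by apply: (sumv_sup x) (subvv _); rewrite xO.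
apply/subv_sumP => y /eqP yO; have := index_orbit_refl y.
by rewrite yO -xO => /imsetP[a _ ->]; rewrite E_line.
Qed.

(** The invariants are the image of [E], hence the sum of the images of the lines.
    Only the regular orbits contribute, each by a line contained in the span of
    that orbit, and these spans are independent. *)
Theorem invariants_monomial : monomial_space invariants orbit_line.
Proof.
split=> [O||].
- have [x xO] := regular_orbit_refl O; rewrite (orbit_lineE xO).
  have [v v0 Lv] := dim1_line (dimL x).
  rewrite -[regular_index _ _ _]negbK -E_line_eq0 Lv limg_line.
  by rewrite -dimv_eq0 dim_vline; case: (E v != 0).
- apply: (directv_sum_inj val_inj (A := fun O : {set X} =>
    E @: \sum_(x | index_orbit rho L x == O) L x)%VS).
  apply: (directv_sum_fibers (d := index_orbit rho L)) dirL => O.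
  apply/subvP => _ /memv_imgP[v /memv_sumP[vs vsL ->] ->].
  rewrite linear_sum; apply: memv_suml => x xO; rewrite /= sum_lfunE.
  apply: memv_suml => a _; apply: subvP (memv_img (rho a) (vsL x xO)).
  rewrite index_actP; apply: (sumv_sup (index_act rho L a x)) (subvv _).
  by rewrite index_orbit_act.
apply/eqP; rewrite -E_invariants -sumL limg_sum eqEsubv.
apply/andP; split; apply/subv_sumP.
  move=> O _; have [x xO _] := regular_orbit_refl O.
  by rewrite (orbit_lineE xO) (sumv_sup x).
move=> x _; have [/eqP->|] := boolP (E @: L x == 0)%VS; first exact: sub0v.
rewrite E_line_eq0 negbK => /orbit_of_regular[O xO].
by rewrite -(orbit_lineE (esym xO)) (sumv_sup O).
Qed.

Corollary dim_invariants : \dim invariants = #|regular_orbits rho L|.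
Proof.
have [dim1 /directvP/= dir <-] := invariants_monomial.
by rewrite dir (eq_bigr (fun=> 1%N)) // sum1_card card_sig.
Qed.

(** An operator commuting with the group commutes with orbit sums, hence maps
    the orbit sum of a line to the orbit sum of the image line. Being injective,
    it keeps the orbit sum nonzero, so the image orbit is again regular. *)
Lemma commuting_permutes_orbit_lines (s : 'End(V)) :
  lker s == 0%VS ->
  (forall a, {in U, forall v, s (rho a v) = rho a (s v)}) ->
  (forall x, exists y, (s @: L x)%VS = L y) ->
  forall O, exists O', (s @: orbit_line O)%VS = orbit_line O'.
Proof.
move=> s0 srho perm_s O; have [x xO regx] := regular_orbit_refl O.
have [y sx] := perm_s x.
have sEx : (s @: (E @: L x) = E @: L y)%VS.
  rewrite -sx -!limg_comp; apply: eq_in_limg => v /(subvP (L_U x)) vU.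
  rewrite !lfunE /= !sum_lfunE linear_sum.
  by apply: eq_bigr => a _; apply: srho.
have /orbit_of_regular[O' yO'] : regular_index rho L y.
  rewrite -[regular_index _ _ _]negbK -E_line_eq0 -sEx -(limg0 s).
  by rewrite (eq_limg_ker0 _ _ s0) E_line_eq0 regx.
by exists O'; rewrite (orbit_lineE xO) sEx -(orbit_lineE (esym yO')).
Qed.

End Invariants.

(** * Tensor products of vector spaces *)

Lemma lfunZ (K : fieldType) (V W : vectType K) (f : 'Hom(V, W)) k v :
  f (k *: v) = k *: f v.
Proof. exact: linearZ. Qed.

Section Spanning.
Variable K : fieldType.
Implicit Types V W : vectType K.

(** Spanning sets are given by predicates because the ones used below, tensors of
    homogeneous vectors, come with the degrees of their factors. *)
Definition spanning V (S : V -> Prop) :=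
  forall U : {vspace V}, (forall v, S v -> v \in U) -> U = fullv.

Lemma spanning_eq V W (S : V -> Prop) (f g : 'Hom(V, W)) :
  spanning S -> (forall v, S v -> f v = g v) -> f = g.
Proof.
move=> spS fg; apply/lfunP => v; apply/eqlfunP.
by rewrite (spS (lker (f - g))) ?memvf // => u /fg/eqlfunP.
Qed.

Lemma spanning_limg V W (S : W -> Prop) (f : 'Hom(V, W)) :
  spanning S -> (forall w, S w -> exists v, f v = w) -> limg f = fullv.
Proof. by move=> spS Sf; apply: spS => _ /Sf[v <-]; rewrite memv_img ?memvf. Qed.

Lemma spanning_true V : spanning (fun _ : V => True).
Proof.
by move=> U VU; apply/eqP; rewrite eqEsubv subvf; apply/subvP => v _; apply: VU.
Qed.

Lemma spanning_sum V (I : finType) (A : I -> {vspace V}) :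
  (\sum_i A i)%VS = fullv -> spanning (fun v => exists i, v \in A i).
Proof.
move=> sumA U AU; apply/eqP; rewrite eqEsubv subvf -sumA.
by apply/subv_sumP => i _; apply/subvP => v vA; apply: AU; exists i.
Qed.

Lemma directv_sum_proj V (I : finType) (A : I -> {vspace V}) (P : I -> 'End(V)) :
  (forall i j v, v \in A i -> P j v = if j == i then v else 0) ->
  directv (\sum_i A i).
Proof.
move=> PA; apply/directv_sum_independent => us usA us0 j _.
have := congr1 (P j) us0; rewrite linear0 linear_sum /= => <-.
rewrite (eq_bigr (fun i => if i == j then us i else 0)).
  by rewrite -big_mkcond big_pred1_eq.
by move=> i _; rewrite (PA i) ?usA // eq_sym.
Qed.

End Spanning.

Section TensorProduct.
Variable K : fieldType.
Implicit Types V W : vectType K.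

Lemma tens_linearl V W (w : W) : linear (fun v : V => tens v w).
Proof.
move=> k u v; apply/matrixP => i j.
by rewrite !mxE linearP /= mulrDl mulrA.
Qed.

Lemma tens_linearr V W (v : V) : linear (fun w : W => tens v w).
Proof.
move=> k u w; apply/matrixP => i j.
by rewrite !mxE linearP /= mulrDr mulrCA.
Qed.

Definition tensl V W (w : W) : {linear V -> tensor V W} :=
  HB.pack (fun v => tens v w)
    (GRing.isLinear.Build _ _ _ _ (fun v : V => tens v w) (tens_linearl w)).

Definition tensr V W (v : V) : {linear W -> tensor V W} :=
  HB.pack (fun w => tens v w)
    (GRing.isLinear.Build _ _ _ _ (fun w : W => tens v w) (tens_linearr v)).

Lemma tensZl V W k (v : V) (w : W) : tens (k *: v) w = k *: tens v w.
Proof. exact: (linearZZ (tensl V w)). Qed.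

Lemma tensZr V W k (v : V) (w : W) : tens v (k *: w) = k *: tens v w.
Proof. exact: (linearZZ (tensr W v)). Qed.

Lemma tens0l V W (w : W) : tens (0 : V) w = 0.
Proof. exact: (linear0 (tensl V w)). Qed.

Lemma tens0r V W (v : V) : tens v (0 : W) = 0.
Proof. exact: (linear0 (tensr W v)). Qed.

Lemma tens_sumr V W I (r : seq I) (P : pred I) (v : V) (F : I -> W) :
  tens v (\sum_(i <- r | P i) F i) = \sum_(i <- r | P i) tens v (F i).
Proof. exact: (linear_sum (tensr W v)). Qed.

Lemma tens_neq0 V W (v : V) (w : W) : v != 0 -> w != 0 -> tens v w != 0.
Proof.
have nz (Z : vectType K) (z : Z) : z != 0 -> exists i, coord (vbasis {:Z}) i z != 0.
  move=> z0; apply/existsP; apply: contraNT z0 => /existsPn z0.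
  rewrite [z](coord_vbasis (memvf z)) big1 // => i _.
  by have /negPn/eqP-> := z0 i; rewrite scale0r.
move=> /nz[i vi] /nz[j wj]; apply/eqP => /matrixP/(_ i j)/eqP.
by rewrite !mxE mulf_eq0 (negPf vi) (negPf wj).
Qed.

(** For a fixed spanning vector [w], the vectors [v] with [tens v w] in [U] form a
    subspace; exchanging the factors then removes the condition on [w]. *)
Lemma spanning_tens V W (S : V -> Prop) (T : W -> Prop) :
  spanning S -> spanning T ->
  spanning (fun t : tensor V W => exists v w, [/\ S v, T w & t = tens v w]).
Proof.
move=> spS spT U STU.
have ST v w : T w -> tens v w \in U.
  move=> Tw; have : v \in (linfun (tensl V w) @^-1: U)%VS.
    rewrite (spS (_ @^-1: U)%VS) ?memvf // => u Su.
    by rewrite -memv_preim lfunE; apply: STU; exists u, w.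
  by rewrite -memv_preim lfunE.
have VW v w : tens v w \in U.
  have : w \in (linfun (tensr W v) @^-1: U)%VS.
    rewrite (spT (_ @^-1: U)%VS) ?memvf // => u Tu.
    by rewrite -memv_preim lfunE; apply: ST.
  by rewrite -memv_preim lfunE.
apply/eqP; rewrite eqEsubv subvf; apply/subvP => M _.
have -> : M = \sum_i \sum_j M i j *: tens (vbasis {:V})`_i (vbasis {:W})`_j.
  apply/matrixP => i j; rewrite summxE (bigD1 i) //= summxE (bigD1 j) //=.
  rewrite !mxE !coord_free ?(basis_free (vbasisP _)) // !eqxx !mulr1.
  rewrite big1 => [|j' /negPf nj]; last first.
    rewrite !mxE !coord_free ?(basis_free (vbasisP _)) //.
    by rewrite nj !mulr0.
  rewrite addr0 big1 ?addr0 // => i' /negPf ni; rewrite summxE big1 // => j' _.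
  rewrite !mxE !coord_free ?(basis_free (vbasisP _)) //.
  by rewrite ni mul0r mulr0.
by apply: memv_suml => i _; apply: memv_suml => j _; rewrite memvZ.
Qed.

Lemma tmap_tens V W V' W' (f : 'Hom(V, V')) (g : 'Hom(W, W')) v w :
  tmap f g (tens v w) = tens (f v) (g w).
Proof.
rewrite tlift_tens // => [u k x y|u k x y].
  by rewrite linearP tens_linearl.
by rewrite linearP tens_linearr.
Qed.

Lemma tmap_onto (W W' Z Z' : vectType K) (f : 'Hom(W, W')) (g : 'Hom(Z, Z')) :
  limg f = fullv -> limg g = fullv -> limg (tmap f g) = fullv.
Proof.
move=> f_onto g_onto; apply: spanning_limg.
  exact: spanning_tens (@spanning_true _ W') (@spanning_true _ Z').
move=> _ [v [u [_ _ ->]]].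
have /memv_imgP[v' _ ->] : v \in limg f by rewrite f_onto memvf.
have /memv_imgP[u' _ ->] : u \in limg g by rewrite g_onto memvf.
by exists (tens v' u'); rewrite tmap_tens.
Qed.

Lemma tmap_comp (W W' W'' Z Z' Z'' : vectType K) (f : 'Hom(W', W''))
    (f' : 'Hom(W, W')) (g : 'Hom(Z', Z'')) (g' : 'Hom(Z, Z')) :
  (tmap f g \o tmap f' g' = tmap (f \o f') (g \o g'))%VF.
Proof.
apply: spanning_eq (spanning_tens (@spanning_true _ W) (@spanning_true _ Z)) _.
by move=> _ [v [u [_ _ ->]]]; rewrite comp_lfunE !tmap_tens !comp_lfunE.
Qed.

Lemma tmap_id_commute V W (f g : 'End(V)) : (f \o g = g \o f)%VF ->
  let F := tmap f (\1%VF : 'End(W)) in let H := tmap g \1%VF in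
  (F \o H = H \o F)%VF.
Proof. by move=> fg /=; rewrite !tmap_comp fg. Qed.

Lemma tmap_id_braid V W (f g : 'End(V)) :
  (f \o (g \o f) = g \o (f \o g))%VF ->
  let F := tmap f (\1%VF : 'End(W)) in let H := tmap g \1%VF in
  (F \o (H \o F) = H \o (F \o H))%VF.
Proof. by move=> fg /=; rewrite !tmap_comp fg. Qed.

(** The associator is a lift whose values are themselves lifts; its bilinearity
    requires that a lift depend linearly on a parameter. *)
Lemma tlift_linear V W (Z U : vectType K) (F : Z -> V -> W -> U) :
  (forall z w, linear (fun v => F z v w)) ->
  (forall z v, linear (F z v)) ->
  (forall v w, linear (fun z => F z v w)) ->
  forall t, linear (fun z => tlift (F z) t).
Proof.
move=> Fl Fr Fz t k x y.
have -> : tlift (F (k *: x + y)) = k *: tlift (F x) + tlift (F y).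
  apply: spanning_eq (spanning_tens (@spanning_true _ V) (@spanning_true _ W)) _.
  move=> _ [v [u [_ _ ->]]].
  by rewrite add_lfunE scale_lfunE !tlift_tens ?Fz.
by rewrite add_lfunE scale_lfunE.
Qed.

Lemma dim_tensor V W : \dim {:tensor V W} = (\dim {:V} * \dim {:W})%N.
Proof. by rewrite dimvf dim_matrix. Qed.

Lemma dim_tensorA V W Z :
  \dim {:tensor (tensor V W) Z} = \dim {:tensor V (tensor W Z)}.
Proof. by rewrite !dim_tensor mulnA. Qed.

Lemma memv_tensv V W (A : {vspace V}) (B : {vspace W}) v w :
  v \in A -> w \in B -> tens v w \in tensv A B.
Proof.
move=> vA wB; rewrite (coord_vbasis vA) (coord_vbasis wB).
rewrite tens_sumr; apply: memv_suml => j _.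
rewrite -[tens _ _]/(tensl V _ _) linear_sum; apply: memv_suml => i _.
rewrite /= tensZl tensZr !memvZ // memv_span //.
apply/allpairsP; exists ((vbasis A)`_i, (vbasis B)`_j).
by rewrite /= !mem_nth ?size_tuple.
Qed.

Lemma tensv_subP V W (A : {vspace V}) (B : {vspace W}) (U : {vspace tensor V W}) :
  (forall v w, v \in A -> w \in B -> tens v w \in U) -> (tensv A B <= U)%VS.
Proof.
move=> ABU; apply/span_subvP => _ /allpairsP[[v w] /= [vA wB ->]].
by apply: ABU; apply: vbasis_mem.
Qed.

Lemma tensv_line V W (v : V) (w : W) :
  tensv <[v]> <[w]> = <[tens v w]>%VS :> {vspace tensor V W}.
Proof.
apply/eqP; rewrite eqEsubv -memvE memv_tensv ?memv_line // andbT.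
apply: tensv_subP => _ _ /vlineP[a ->] /vlineP[b ->].
by rewrite tensZl tensZr !memvZ ?memv_line.
Qed.

(** The tensor products of the projections onto the summands are projections onto
    the products of the summands. *)
Lemma directv_tensv V W (I J : finType) (A : I -> {vspace V})
    (B : J -> {vspace W}) :
  directv (\sum_i A i) -> directv (\sum_j B j) ->
  directv (\sum_(p : I * J) tensv (A p.1) (B p.2)).
Proof.
move=> dA dB; pose P (p : I * J) := tmap (sumv_pi (\sum_i A i)%VS p.1)
                                     (sumv_pi (\sum_j B j)%VS p.2).
apply: (directv_sum_proj (P := P)) => p q t tAB; pose c := (q == p)%:R : K.
suff /eqlfunP-> : t \in lker (P q - c *: \1%VF).
  by rewrite scale_lfunE id_lfunE /c; case: eqP; rewrite ?scale1r ?scale0r.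
apply: subvP tAB; apply: tensv_subP => v w vA wB; apply/eqlfunP.
rewrite scale_lfunE id_lfunE tmap_tens (sumv_pi_direct _ dA vA).
rewrite (sumv_pi_direct _ dB wB) /c; case: q p {c vA wB} => q1 q2 [p1 p2] /=.
rewrite xpair_eqE; case: eqP => _ /=; case: eqP => _ /=.
all: by rewrite ?tens0l ?tens0r ?scale0r ?scale1r.
Qed.

Lemma tensv_sum_full V W (I J : finType) (A : I -> {vspace V})
    (B : J -> {vspace W}) :
  (\sum_i A i)%VS = fullv -> (\sum_j B j)%VS = fullv ->
  (\sum_(p : I * J) tensv (A p.1) (B p.2))%VS = fullv.
Proof.
move=> /spanning_sum spA /spanning_sum spB.
apply: (spanning_tens spA spB) => _ [v [w [[i vA] [j wB] ->]]].
by apply: subvP (memv_tensv vA wB); rewrite (sumv_sup (i, j)).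
Qed.

End TensorProduct.

(** * Identities for 3-cocycles *)

Section CocycleIdentities.
Variables (R : realType) (G : finGroupType) (w : cocycle3 R G).
Implicit Types a b c d f g h k l p : G.

Lemma lconjM g h k : lconj (g * h)%g k = lconj g (lconj h k).
Proof. by rewrite /lconj invMg !mulgA. Qed.

Lemma lconj_mul g h k : lconj g (h * k)%g = (lconj g h * lconj g k)%g.
Proof. by rewrite /lconj !mulgA mulgKV. Qed.

Lemma lconj_mulr g h : (lconj g h * g = g * h)%g.
Proof. by rewrite /lconj mulgKV. Qed.

Lemma lconjg1 g : lconj g 1%g = 1%g.
Proof. by rewrite /lconj mulg1 mulgV. Qed.

Lemma lconj1g h : lconj 1%g h = h.
Proof. by rewrite /lconj mul1g invg1 mulg1. Qed.

(** Solves the cocycle condition for its first factor. *)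
Lemma cocycle_eq1 a b c d : w (a * b)%g c d =
  w a b c * w a (b * c)%g d * w b c d / w a b (c * d)%g.
Proof. by rewrite -omega_cocycle mulfK // omega_neq0. Qed.

(** Solves the cocycle condition for its middle factor. *)
Lemma cocycle_eq_mid a b c d : w a (b * c)%g d =
  w (a * b)%g c d * w a b (c * d)%g / (w a b c * w b c d).
Proof. by rewrite cocycle_eq1; field; rewrite !omega_neq0. Qed.

Lemma omega1l a b : w 1%g a b = 1.
Proof.
have := omega_cocycle w 1%g 1%g a b.
rewrite !mul1g !omega_normalized mul1r mulr1.
rewrite -[X in X = _]mul1r => /mulIf-> //; exact: omega_neq0.
Qed.

Lemma omega1r a b : w a b 1%g = 1.
Proof.
have := omega_cocycle w a b 1%g 1%g.
rewrite !mulg1 !omega_normalized mulr1 mul1r.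
rewrite -[X in X = _]mulr1 => /mulfI-> //; exact: omega_neq0.
Qed.

Lemma omega_act_neq0 g h k : omega_act w g h k != 0.
Proof. by rewrite /omega_act !(mulf_neq0, invr_neq0) ?omega_neq0. Qed.

Lemma omega_tens_neq0 g f h : omega_tens w g f h != 0.
Proof. by rewrite /omega_tens !(mulf_neq0, invr_neq0) ?omega_neq0. Qed.

(** This makes the twisted action a genuine one in degree [1]. *)
Lemma omega_act1 g h : omega_act w g h 1%g = 1.
Proof.
by rewrite /omega_act !lconjg1 omega1l omega1r omega_normalized invr1 !mulr1.
Qed.

(** The scalar of a braid generator behind a prefix of degree [p]. *)
Definition omega_braid p a b : R[i] := w p a b / w p (lconj a b) a.

Lemma omega_braid_neq0 p a b : omega_braid p a b != 0.
Proof. by rewrite /omega_braid !(mulf_neq0, invr_neq0) ?omega_neq0. Qed.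

Lemma omega_braid1 a b : omega_braid 1%g a b = 1.
Proof. by rewrite /omega_braid !omega1l invr1 mulr1. Qed.

(** The scalar part of the Yang-Baxter relation. Once the values of [w] at products
    with [p] are expanded, the factors that do not involve [p] cancel against
    those of [omega_act], and the others match in pairs. *)
Lemma omega_braid_relation p a b c :
  omega_braid p a b * omega_braid (p * lconj a b)%g a c
    * omega_braid p (lconj a b) (lconj a c) * omega_act w a b c =
  omega_braid (p * a)%g b c * omega_braid p a (lconj b c)
    * omega_braid (p * lconj a (lconj b c))%g a b
    * omega_act w (lconj a b) a c.
Proof.
have eBa : lconj (lconj a b * a)%g c = lconj a (lconj b c).
  by rewrite lconj_mulr lconjM.
have eBD : lconj (lconj a b) (lconj a c) = lconj a (lconj b c).
  by rewrite -lconjM eBa.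
rewrite /omega_braid /omega_act eBa eBD -lconjM lconjM.
have Ba := lconj_mulr a b; have Da := lconj_mulr a c.
have EB := lconj_mulr (lconj a b) (lconj a c); have Cb := lconj_mulr b c.
have Ea := lconj_mulr a (lconj b c); move: Ba Da EB Cb Ea; rewrite eBD.
set B := lconj a b; set D := lconj a c; set C := lconj b c; set E := lconj a C.
move=> Ba Da EB Cb Ea.
rewrite (cocycle_eq1 p B a c) (cocycle_eq1 p B D a) (cocycle_eq1 p a b c).
rewrite (cocycle_eq1 p a C b) (cocycle_eq1 p E a b) (cocycle_eq1 p E B a).
rewrite Ba Da -EB Cb -Ea.
by field; rewrite !omega_neq0.
Qed.

(** The associator commutes with the twisted action of [h]. *)
Lemma omega_tens_assoc h f g k :
  omega_tens w h (f * g)%g k * omega_tens w h f g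
    * w (lconj h f) (lconj h g) (lconj h k) =
  w f g k * omega_tens w h f (g * k)%g * omega_tens w h g k.
Proof.
rewrite /omega_tens !lconj_mul.
have F := lconj_mulr h f; have GG := lconj_mulr h g; have KK := lconj_mulr h k.
move: F GG KK.
set f1 := lconj h f; set g1 := lconj h g; set k1 := lconj h k => fh gh kh.
rewrite (cocycle_eq1 f1 g1 h k) (cocycle_eq1 f1 g1 k1 h) gh kh.
rewrite (cocycle_eq_mid f1 h g k) (cocycle_eq_mid h f g k) fh.
by field; rewrite !omega_neq0.
Qed.

(** The twisted action on a tensor product satisfies the rule of a twisted
    action. *)
Lemma omega_tens_act g h f k :
  omega_tens w (g * h)%g f k * omega_act w g h f * omega_act w g h k =
  omega_act w g h (f * k)%g * omega_tens w g (lconj h f) (lconj h k)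
    * omega_tens w h f k.
Proof.
rewrite /omega_tens /omega_act !lconjM (lconj_mul h f k).
rewrite (lconj_mul g (lconj h f) (lconj h k)).
have fh := lconj_mulr h f; have kh := lconj_mulr h k.
have Fg := lconj_mulr g (lconj h f); have Kg := lconj_mulr g (lconj h k).
move: fh kh Fg Kg.
set f1 := lconj h f; set k1 := lconj h k.
set F := lconj g f1; set T := lconj g k1 => fh kh Fg Tg.
rewrite (cocycle_eq1 g h f k) (cocycle_eq1 F T g h) (cocycle_eq_mid F g h k).
rewrite Tg (cocycle_eq_mid F g k1 h) Fg (cocycle_eq1 g f1 h k).
rewrite (cocycle_eq1 g f1 k1 h) fh kh.
by field; rewrite !omega_neq0.
Qed.

(** The braiding commutes with the twisted action of [h]. *)
Lemma omega_tens_braid h g l :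
  omega_tens w h (lconj g l) g * omega_act w (lconj h g) h l =
  omega_tens w h g l * omega_act w h g l.
Proof.
rewrite /omega_tens /omega_act.
have -> : lconj (lconj h g * h)%g l = lconj h (lconj g l).
  by rewrite lconj_mulr lconjM.
rewrite lconjM; by field; rewrite !omega_neq0.
Qed.

(** A braid generator commutes with the twisted action of [h]: conjugating the
    braiding by the associator combines the two previous identities. *)
Lemma omega_braid_tens h p a b :
  omega_tens w h (p * a)%g b * omega_tens w h p a
    * omega_braid (lconj h p) (lconj h a) (lconj h b) * omega_act w h a b =
  omega_braid p a b * omega_tens w h (p * lconj a b)%g a
    * omega_tens w h p (lconj a b) * omega_act w (lconj h a) h b.
Proof.
have A1 := omega_tens_assoc h p a b.
have A2 := omega_tens_assoc h p (lconj a b) a.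
have := omega_tens_braid h a b; rewrite lconj_mulr in A2.
have e : lconj (lconj h a) (lconj h b) = lconj h (lconj a b).
  by rewrite -lconjM lconj_mulr lconjM.
rewrite /omega_braid e.
move: A1 A2.
have := omega_neq0 w p a b; have := omega_neq0 w p (lconj a b) a.
have := omega_neq0 w (lconj h p) (lconj h a) (lconj h b).
have := omega_neq0 w (lconj h p) (lconj h (lconj a b)) (lconj h a).
move: (w p a b) (w p (lconj a b) a) (w (lconj h p) (lconj h a) (lconj h b))
  (w (lconj h p) (lconj h (lconj a b)) (lconj h a)) => x1 x2 y1 y2 y20 y10 x20 x10.
move=> A1 A2 B.
rewrite -[x1 / x2 * _ * _]mulrA (canRL (mulfK y10) A1) (canRL (mulfK y20) A2).
rewrite (canRL (mulfK (omega_act_neq0 (lconj h a) h b)) B).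
by field; rewrite y10 y20 x20 omega_act_neq0.
Qed.

End CocycleIdentities.

(** * Tensor products of graded modules *)

(* Conversion between two tensor modules would otherwise unfold down to matrix
   coefficients. *)
Local Opaque tens tlift tensv homproj.

Lemma sum_eq1 (V : nmodType) (I : finType) (F : I -> V) i :
  (forall j, j != i -> F j = 0) -> \sum_j F j = F i.
Proof. by move=> F0; rewrite (bigD1 i) //= big1 ?addr0. Qed.

Section TensorModules.
Variables (R : realType) (G : finGroupType) (w : cocycle3 R G).
Implicit Types V W Z : graded_module R G.

Definition graded V :=
  directv (\sum_g degpart V g) /\ (\sum_g degpart V g)%VS = fullv.

Lemma object_graded V : is_object w V -> graded V. Proof. by case. Qed.

Definition homogeneous V (v : V) := exists g, v \in degpart V g.

Lemma spanning_homogeneous V : graded V -> spanning (@homogeneous V).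
Proof. by case=> _; apply: spanning_sum. Qed.

Lemma homproj_degpart V g h (v : V) : graded V -> v \in degpart V g ->
  homproj V h v = if h == g then v else 0.
Proof. by case=> dV _; apply: sumv_pi_direct. Qed.

Lemma tens_degpart V W g h (v : V) (u : W) :
  v \in degpart V g -> u \in degpart W h ->
  tens v u \in degpart (tensor_module w V W) (g * h)%g.
Proof.
move=> vg uh; apply: (subvP (sumv_sup g _ (subvv _))) => //.
by apply: memv_tensv; rewrite ?mulKg.
Qed.

Lemma spanning_tens_homogeneous V W : graded V -> graded W ->
  spanning (fun t : tensor_module w V W => exists g h v u,
    [/\ v \in degpart V g, u \in degpart W h & t = tens v u]).
Proof.
move=> gV gW U SU.
apply: (spanning_tens (spanning_homogeneous gV) (spanning_homogeneous gW)).
by move=> _ [v [u [[g vg] [h uh] ->]]]; apply: SU; exists g, h, v, u.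
Qed.

Lemma twact_tens V W h g l (v : V) (u : W) : graded V -> graded W ->
  v \in degpart V g -> u \in degpart W l ->
  twact (tensor_module w V W) h (tens v u) =
    omega_tens w h g l *: tens (twact V h v) (twact W h u).
Proof.
move=> gV gW vg ul; rewrite [twact _ _]/= tlift_tens => [|u' k x y|v' k x y].
- rewrite (sum_eq1 (i := g)) => [|g' /negPf ng].
    rewrite (sum_eq1 (i := l)) => [|l' /negPf nl].
      by rewrite (homproj_degpart g gV vg) (homproj_degpart l gW ul) !eqxx.
    by rewrite (homproj_degpart l' gW ul) nl linear0 tens0r scaler0.
  apply: big1 => l' _.
  by rewrite (homproj_degpart g' gV vg) ng linear0 tens0l scaler0.
- rewrite scaler_sumr -big_split; apply: eq_bigr => g' _ /=.
  rewrite scaler_sumr -big_split; apply: eq_bigr => l' _ /=.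
  by rewrite !linearP tens_linearl scalerDr !scalerA mulrC.
rewrite scaler_sumr -big_split; apply: eq_bigr => g' _ /=.
rewrite scaler_sumr -big_split; apply: eq_bigr => l' _ /=.
by rewrite !linearP tens_linearr scalerDr !scalerA mulrC.
Qed.

Lemma tensor_graded V W : graded V -> graded W -> graded (tensor_module w V W).
Proof.
move=> [dV sV] [dW sW]; split.
  have dVW := directv_tensv dV dW.
  apply: (directv_sum_fibers (d := fun p : G * G => (p.1 * p.2)%g)) dVW => g.
  apply/subv_sumP => h _.
  by apply: (sumv_sup (h, h^-1 * g)%g) => //=; rewrite mulKVg.
apply/eqP; rewrite eqEsubv subvf -(tensv_sum_full sV sW).
apply/subv_sumP => -[g h] _; apply: (sumv_sup (g * h)%g) => //=.
by apply: (sumv_sup g) => //; rewrite mulKg.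
Qed.

(** A linear condition on a homogeneous component of a tensor product can be
    checked on tensors of homogeneous vectors. *)
Lemma degpart_tensorP V W k (U : {vspace tensor_module w V W}) :
  (forall g h v u, (g * h)%g = k -> v \in degpart V g -> u \in degpart W h ->
     tens v u \in U) ->
  (degpart (tensor_module w V W) k <= U)%VS.
Proof.
move=> VWU; apply/subv_sumP => h _; apply: tensv_subP => v u vh uh.
by apply: VWU vh uh; rewrite mulKVg.
Qed.

Lemma object_twact V g h (v : V) : is_object w V -> v \in degpart V h ->
  twact V g v \in degpart V (lconj g h).
Proof. by case=> _ _ _ dV vh; apply: (subvP (dV g h)); apply: memv_img. Qed.

Theorem tensor_object V W :
  is_object w V -> is_object w W -> is_object w (tensor_module w V W).
Proof.
move=> oV oW; have gV := object_graded oV; have gW := object_graded oW.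
have [_ V1 VM _] := oV; have [_ W1 WM _] := oW.
split; first exact: tensor_graded.
- suff -> : twact (tensor_module w V W) 1%g = \1%VF by move=> v; rewrite lfunE.
  apply: spanning_eq (spanning_tens_homogeneous gV gW) _.
  move=> _ [g [h [v [u [vg uh ->]]]]].
  rewrite (twact_tens _ gV gW vg uh) V1 W1 lfunE /omega_tens !lconj1g.
  by rewrite omega1l omega1r omega_normalized mulr1 invr1 mulr1 scale1r.
- (* The twisted action becomes a variable, known only by its values on
     homogeneous tensors, so that no step compares the actions of two
     elements by unfolding. *)
  move=> g h k; pose t x := twact (tensor_module w V W) x.
  have act x a b v u (va : v \in degpart V a) (ub : u \in degpart W b) :
    t x (tens v u) = _ := twact_tens x gV gW va ub.
  rewrite -/(t _) -/(t _) -/(t _); move: t act => t act.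
  suff /subvP sk : (degpart (tensor_module w V W) k
      <= lker (t (g * h)%g - omega_act w g h k *: (t g \o t h)%VF))%VS.
    by move=> v /sk/eqlfunP ->; rewrite scale_lfunE comp_lfunE.
  apply: degpart_tensorP => a b v u <- va ub; apply/eqlfunP.
  rewrite scale_lfunE comp_lfunE (act _ _ _ _ _ va ub) (act _ _ _ _ _ va ub).
  rewrite linearZ /= (act _ _ _ _ _ (object_twact h oV va) (object_twact h oW ub)).
  rewrite (VM _ _ _ _ va) (WM _ _ _ _ ub) tensZl tensZr !scalerA.
  by rewrite mulrA omega_tens_act [in RHS]mulrAC.
move=> g h; apply/subvP => _ /memv_imgP[t th ->].
rewrite memv_preim; apply: subvP th; apply: degpart_tensorP => a b v u <- va ub.
rewrite -memv_preim (twact_tens _ gV gW va ub) memvZ // lconj_mul.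
by apply: tens_degpart; apply: object_twact.
Qed.

End TensorModules.

(** * Braiding and associator as morphisms *)

Lemma onto_lker0 (K : fieldType) (V W : vectType K) (f : 'Hom(V, W)) :
  \dim {:V} = \dim {:W} -> limg f = fullv -> lker f == 0%VS.
Proof.
move=> dVW f_onto; have := limg_ker_dim f fullv.
by rewrite capfv f_onto dVW => /eqP; rewrite -[X in _ == X]add0n eqn_add2r dimv_eq0.
Qed.

Section Morphisms.
Variables (R : realType) (G : finGroupType) (w : cocycle3 R G).
Implicit Types P V W Z : graded_module R G.

Lemma is_morphismP V W (f : 'Hom(V, W)) : reflect
  ((forall g v, v \in degpart V g -> f v \in degpart W g) /\
   (forall g v, f (twact V g v) = twact W g (f v)))
  (is_morphism f).
Proof.
apply: (iffP andP) => -[fdeg fact]; split.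
- move=> g v vg; apply: (subvP (forallP fdeg g)); exact: memv_img.
- move=> g v; have /eqP/lfunP/(_ v) := forallP fact g.
  by rewrite !comp_lfunE.
- apply/forallP => g; apply/subvP => _ /memv_imgP[v vg ->]; exact: fdeg.
by apply/forallP => g; apply/eqP/lfunP => v; rewrite !comp_lfunE.
Qed.

Lemma tensor_morphismP V W Z (f : 'Hom(tensor_module w V W, Z)) :
  graded V -> graded W ->
  (forall g h v u, v \in degpart V g -> u \in degpart W h ->
     f (tens v u) \in degpart Z (g * h)%g /\
     forall k, f (twact (tensor_module w V W) k (tens v u)) =
               twact Z k (f (tens v u))) ->
  is_morphism f.
Proof.
move=> gV gW fVW; apply/andP; split; apply/forallP => k.
  apply/subvP => _ /memv_imgP[t tk ->]; rewrite memv_preim.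
  apply: subvP tk; apply: degpart_tensorP => g h v u <- vg uh.
  by rewrite -memv_preim; have [] := fVW _ _ _ _ vg uh.
apply/eqP; apply: spanning_eq (spanning_tens_homogeneous gV gW) _.
move=> _ [g [h [v [u [vg uh ->]]]]]; rewrite !comp_lfunE.
by have [_ ->] := fVW _ _ _ _ vg uh.
Qed.

Lemma tmap_morphism V W V' W' (f : 'Hom(V, V')) (g : 'Hom(W, W')) :
    graded V -> graded W -> graded V' -> graded W' ->
  is_morphism f -> is_morphism g ->
  is_morphism (tmap f g : 'Hom(tensor_module w V W, tensor_module w V' W')).
Proof.
move=> gV gW gV' gW' /is_morphismP[df cf] /is_morphismP[dg cg].
apply: (tensor_morphismP gV gW) => a b v u va ub; split=> [|k].
  by rewrite tmap_tens; apply: tens_degpart; [apply: df | apply: dg].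
have := twact_tens w k gV gW va ub.
have := twact_tens w k gV' gW' (df _ _ va) (dg _ _ ub).
rewrite tmap_tens; move: (twact (tensor_module w V' W') k) => t'.
move: (twact (tensor_module w V W) k) => t -> ->.
by rewrite linearZ /= tmap_tens cf cg.
Qed.

Lemma braiding_tens V W a (v : V) (u : W) : graded V ->
  v \in degpart V a -> braiding w V W (tens v u) = tens (twact W a u) v.
Proof.
move=> gV va; rewrite /braiding tlift_tens => [|u' k x y|v' k x y].
- rewrite (sum_eq1 (i := a)) => [|b /negPf nb].
    by rewrite (homproj_degpart a gV va) eqxx.
  by rewrite (homproj_degpart b gV va) nb tens0r.
- rewrite scaler_sumr -big_split; apply: eq_bigr => b _ /=.
  by rewrite !linearP tens_linearr.
rewrite scaler_sumr -big_split; apply: eq_bigr => b _ /=.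
by rewrite !linearP tens_linearl.
Qed.

Lemma twact_onto V g : is_object w V -> limg (twact V g) = fullv.
Proof.
move=> oV; have [_ V1 VM _] := oV.
apply: spanning_limg (spanning_homogeneous (object_graded oV)) _ => v [h vh].
exists (omega_act w g g^-1%g h *: twact V g^-1%g v).
by rewrite linearZ /= -(VM _ _ _ _ vh) mulgV V1.
Qed.

Lemma braiding_onto V W : graded V -> is_object w W ->
  limg (braiding w V W) = fullv.
Proof.
move=> gV oW; apply: spanning_limg.
  apply: spanning_tens (spanning_homogeneous (object_graded oW))
                       (spanning_homogeneous gV).
move=> _ [u [v [_ [a va] ->]]].
have /memv_imgP[u' _ ->] : u \in limg (twact W a) by rewrite twact_onto ?memvf.
by exists (tens v u'); rewrite (braiding_tens u' gV va).
Qed.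

Lemma associator_tens V W Z a b c (v : V) (u : W) (z : Z) :
    graded V -> graded W -> graded Z ->
    v \in degpart V a -> u \in degpart W b -> z \in degpart Z c ->
  associator w V W Z (tens (tens v u) z) = w a b c *: tens v (tens u z).
Proof.
move=> gV gW gZ va ub zc; rewrite /associator.
pose F (z : Z) (v : V) (u : W) : tensor V (tensor W Z) :=
  \sum_a \sum_b \sum_c
    w a b c *: tens (homproj V a v) (tens (homproj W b u) (homproj Z c z)).
have Fl z' u' : linear (fun v' => F z' v' u').
  move=> k x y; rewrite /F scaler_sumr -big_split; apply: eq_bigr => a' _ /=.
  rewrite scaler_sumr -big_split; apply: eq_bigr => b' _ /=.
  rewrite scaler_sumr -big_split; apply: eq_bigr => c' _ /=.
  by rewrite linearP tens_linearl scalerDr !scalerA mulrC.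
have Fr z' v' : linear (fun u' => F z' v' u').
  move=> k x y; rewrite /F scaler_sumr -big_split; apply: eq_bigr => a' _ /=.
  rewrite scaler_sumr -big_split; apply: eq_bigr => b' _ /=.
  rewrite scaler_sumr -big_split; apply: eq_bigr => c' _ /=.
  by rewrite linearP tens_linearl tens_linearr scalerDr !scalerA mulrC.
have Fz v' u' : linear (fun z' => F z' v' u').
  move=> k x y; rewrite /F scaler_sumr -big_split; apply: eq_bigr => a' _ /=.
  rewrite scaler_sumr -big_split; apply: eq_bigr => b' _ /=.
  rewrite scaler_sumr -big_split; apply: eq_bigr => c' _ /=.
  by rewrite linearP !tens_linearr scalerDr !scalerA mulrC.
have tF z' v' u' : tlift (F z') (tens v' u') = F z' v' u' by apply: tlift_tens.
rewrite tlift_tens => [|z' k x y|t k x y]; last 2 first.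
- by rewrite linearP.
- exact: (tlift_linear Fl Fr Fz).
rewrite tF /F (sum_eq1 (i := a)) => [|a' /negPf na]; last first.
  apply: big1 => b' _; apply: big1 => c' _.
  by rewrite (homproj_degpart a' gV va) na tens0l scaler0.
rewrite (sum_eq1 (i := b)) => [|b' /negPf nb]; last first.
  apply: big1 => c' _.
  by rewrite (homproj_degpart b' gW ub) nb tens0l tens0r scaler0.
rewrite (sum_eq1 (i := c)) => [|c' /negPf nc]; last first.
  by rewrite (homproj_degpart c' gZ zc) nc !tens0r scaler0.
rewrite (homproj_degpart a gV va) (homproj_degpart b gW ub).
by rewrite (homproj_degpart c gZ zc) !eqxx.
Qed.

(** The associator is onto because the values of [w] are invertible, and source and
    target have the same dimension. *)
Lemma associator_lker0 V W Z : graded V -> graded W -> graded Z ->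
  lker (associator w V W Z) == 0%VS.
Proof.
move=> gV gW gZ; apply: onto_lker0.
  exact: dim_tensorA.
apply: spanning_limg.
  apply: spanning_tens (spanning_homogeneous gV)
    (spanning_tens (spanning_homogeneous gW) (spanning_homogeneous gZ)).
move=> _ [v [_ [[a va] [u [z [[b ub] [c zc] ->]]] ->]]].
exists ((w a b c)^-1 *: tens (tens v u) z).
rewrite linearZ /= (associator_tens gV gW gZ va ub zc) scalerA mulVf ?scale1r //.
exact: omega_neq0.
Qed.

(** The braiding of the last two factors of [(P (x) V) (x) V]. *)
Definition braid_last P V : 'End(tensor_module w (tensor_module w P V) V) :=
  ((associator w P V V)^-1 \o tmap \1 (braiding w V V) \o associator w P V V)%VF.

Lemma braid_last_tens P V p a b (t : P) (v u : V) :
    graded P -> is_object w V ->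
    t \in degpart P p -> v \in degpart V a -> u \in degpart V b ->
  braid_last P V (tens (tens t v) u) =
    omega_braid w p a b *: tens (tens t (twact V a u)) v.
Proof.
move=> gP oV tp va ub; have gV := object_graded oV.
have A := associator_tens gP gV gV tp va ub.
have B := associator_tens gP gV gV tp (object_twact a oV ub) va.
have injA := associator_lker0 gP gV gV.
rewrite /braid_last comp_lfunE A linearZ /= comp_lfunE tmap_tens id_lfunE.
rewrite (braiding_tens u gV va) /omega_braid -scalerA; congr (_ *: _).
apply: (canLR (lker0_lfunK injA)).
by rewrite linearZ /= B scalerA mulVf ?scale1r // omega_neq0.
Qed.

End Morphisms.

(** * The braid relations *)

Section BraidRelations.
Variables (R : realType) (G : finGroupType) (w : cocycle3 R G).
Implicit Types P V W Z : graded_module R G.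

(** Both sides are [h * a] acting on [u], as [lconj h a * h = h * a]. *)
Lemma twact_swap V h a b (u : V) : is_object w V -> u \in degpart V b ->
  omega_act w (lconj h a) h b *: twact V (lconj h a) (twact V h u) =
  omega_act w h a b *: twact V h (twact V a u).
Proof.
case=> _ _ VM _ ub; rewrite -(VM _ _ _ _ ub) -(VM _ _ _ _ ub).
by rewrite lconj_mulr.
Qed.

Lemma braiding_morphism V : is_object w V -> is_morphism (braiding w V V).
Proof.
move=> oV; have gV := object_graded oV.
apply: (tensor_morphismP gV gV) => a b v u va ub; split=> [|k].
  rewrite (braiding_tens w u gV va) -lconj_mulr.
  exact: tens_degpart (object_twact a oV ub) va.
have T := twact_tens w k gV gV; pose t := twact (tensor_module w V V) k.
have {}T c d x y (xc : x \in degpart V c) (yd : y \in degpart V d) :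
  t (tens x y) = _ := T c d x y xc yd.
rewrite -/t; move: t T => t T; rewrite (T _ _ _ _ va ub) lfunZ.
rewrite (braiding_tens w u gV va) (T _ _ _ _ (object_twact a oV ub) va).
rewrite (braiding_tens w _ gV (object_twact k oV va)).
rewrite -[twact V (lconj k a) _](scalerK (omega_act_neq0 w (lconj k a) k b)).
rewrite (twact_swap k a oV ub) !tensZl !scalerA; congr (_ *: _).
apply: (mulIf (omega_act_neq0 w (lconj k a) k b)).
by rewrite omega_tens_braid; field; rewrite omega_act_neq0.
Qed.

Lemma spanning_tens3 P V W : graded P -> graded V -> graded W ->
  spanning (fun t : tensor_module w (tensor_module w P V) W =>
    exists p a b x v u, [/\ x \in degpart P p, v \in degpart V a,
      u \in degpart W b & t = tens (tens x v) u]).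
Proof.
move=> gP gV gW U SU.
apply: (spanning_tens (spanning_tens_homogeneous gP gV) (spanning_homogeneous gW)).
move=> _ [_ [u [[p [a [x [v [xp va ->]]]]] [b ub] ->]]].
by apply: SU; exists p, a, b, x, v, u.
Qed.

Lemma degpart_tensor3P P V W k
    (U : {vspace tensor_module w (tensor_module w P V) W}) :
  (forall p a b x v u, (p * a * b)%g = k -> x \in degpart P p ->
     v \in degpart V a -> u \in degpart W b -> tens (tens x v) u \in U) ->
  (degpart (tensor_module w (tensor_module w P V) W) k <= U)%VS.
Proof.
move=> PVWU; apply: degpart_tensorP => g b t u gb tg ub.
suff : (degpart (tensor_module w P V) g <= linfun (tensl _ u) @^-1: U)%VS.
  by move=> /subvP/(_ t tg); rewrite -memv_preim lfunE.
apply: degpart_tensorP => p a x v pa xp va.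
by rewrite -memv_preim lfunE; apply: (PVWU p a b); rewrite ?pa.
Qed.

Lemma braid_last_morphism P V : is_object w P -> is_object w V ->
  is_morphism (braid_last w P V).
Proof.
move=> oP oV; have gP := object_graded oP; have gV := object_graded oV.
have gPV := tensor_graded w gP gV.
pose f := braid_last w P V.
have F p a b x v u (xp : x \in degpart P p) (va : v \in degpart V a)
  (ub : u \in degpart V b) : f (tens (tens x v) u) = _ :=
  braid_last_tens gP oV xp va ub.
rewrite -/f; move: f F => f F.
apply/andP; split; apply/forallP => k.
  apply/subvP => _ /memv_imgP[t tk ->]; rewrite memv_preim; apply: subvP tk.
  apply: degpart_tensor3P => p a b x v u <- xp va ub.
  rewrite -memv_preim (F _ _ _ _ _ _ xp va ub) memvZ //.
  have -> : (p * a * b = p * lconj a b * a)%g.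
    by rewrite -[LHS]mulgA -[RHS]mulgA lconj_mulr.
  exact: tens_degpart (tens_degpart w xp (object_twact a oV ub)) va.
apply/eqP; apply: spanning_eq (spanning_tens3 gP gV gV) _.
move=> _ [p [a [b [x [v [u [xp va ub ->]]]]]]]; rewrite !comp_lfunE.
pose t1 := twact (tensor_module w P V) k.
have T1 c d y z (yc : y \in degpart P c) (zd : z \in degpart V d) :
  t1 (tens y z) = _ := twact_tens w k gP gV yc zd.
pose t2 := twact (tensor_module w (tensor_module w P V) V) k.
have T2 c d e y z z' (yc : y \in degpart P c) (zd : z \in degpart V d)
    (z'e : z' \in degpart V e) :
  t2 (tens (tens y z) z') = omega_tens w k (c * d)%g e *:
    tens (t1 (tens y z)) (twact V k z') :=
  twact_tens w k gPV gV (tens_degpart w yc zd) z'e.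
rewrite -/t2; move: t1 t2 T1 T2 => t1 t2 T1 T2.
have kx := object_twact k oP xp; have kv := object_twact k oV va.
have ku := object_twact k oV ub; have au := object_twact a oV ub.
rewrite (T2 _ _ _ _ _ _ xp va ub) (T1 _ _ _ _ xp va) tensZl scalerA.
rewrite lfunZ (F _ _ _ _ _ _ kx kv ku) (F _ _ _ _ _ _ xp va ub).
rewrite lfunZ (T2 _ _ _ _ _ _ xp au va) (T1 _ _ _ _ xp au).
rewrite -[twact V (lconj k a) _](scalerK (omega_act_neq0 w (lconj k a) k b)).
rewrite (twact_swap k a oV ub) !(tensZl, tensZr) !scalerA; congr (_ *: _).
apply: (mulIf (omega_act_neq0 w (lconj k a) k b)).
by rewrite -omega_braid_tens; field; rewrite omega_act_neq0.
Qed.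

(** A tensor [(x (x) u) (x) v] with [v] of degree [a] comes from
    [(x (x) v) (x) (a^-1 |> u)], up to an invertible scalar. *)
Lemma braid_last_onto P V : graded P -> is_object w V ->
  limg (braid_last w P V) = fullv.
Proof.
move=> gP oV; have gV := object_graded oV.
apply: spanning_limg (spanning_tens3 gP gV gV) _.
move=> _ [p [c [a [x [u [v [xp uc va ->]]]]]]].
have [_ V1 VM _] := oV.
have u'P := object_twact a^-1%g oV uc.
have [s s0 us] : exists2 s, s != 0 & u = s *: twact V a (twact V a^-1%g u).
  exists (omega_act w a a^-1%g c); first exact: omega_act_neq0.
  by rewrite -(VM _ _ _ _ uc) mulgV V1.
have := braid_last_tens gP oV xp va u'P.
move: (omega_braid_neq0 w p a (lconj a^-1%g c)).
move: (omega_braid w p a (lconj a^-1%g c)) => r r0.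
move: (braid_last w P V) => f fE.
exists ((s / r) *: tens (tens x v) (twact V a^-1%g u)).
by rewrite lfunZ fE scalerA mulfVK // [in RHS]us tensZr tensZl.
Qed.

(** The Yang-Baxter relation on [((P (x) V) (x) V) (x) V]. *)
Lemma braid_last_relation P V : graded P -> is_object w V ->
  let s1 := tmap (braid_last w P V) \1%VF in
  let s2 := braid_last w (tensor_module w P V) V in
  (s1 \o (s2 \o s1) = s2 \o (s1 \o s2))%VF.
Proof.
move=> gP oV; have gV := object_graded oV; have gPV := tensor_graded w gP gV.
pose f := braid_last w P V.
have F p a b x v u (xp : x \in degpart P p) (va : v \in degpart V a)
  (ub : u \in degpart V b) : f (tens (tens x v) u) = _ :=
  braid_last_tens gP oV xp va ub.
rewrite /= -/f; move: f F => f F.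
pose s2 := braid_last w (tensor_module w P V) V.
have S2 p a b c x v1 v2 v3 (xp : x \in degpart P p) (v1a : v1 \in degpart V a)
   (v2b : v2 \in degpart V b) (v3c : v3 \in degpart V c) :
   s2 (tens (tens (tens x v1) v2) v3) =
     omega_braid w (p * a)%g b c *:
       tens (tens (tens x v1) (twact V b v3)) v2 :=
  braid_last_tens gPV oV (tens_degpart w xp v1a) v2b v3c.
rewrite -/s2; move: s2 S2 => s2 S2.
pose s1 := tmap f (\1%VF : 'End(V)).
have S1 p a b x v1 v2 v3 (xp : x \in degpart P p) (v1a : v1 \in degpart V a)
   (v2b : v2 \in degpart V b) :
   s1 (tens (tens (tens x v1) v2) v3) =
     omega_braid w p a b *: tens (tens (tens x (twact V a v2)) v1) v3.
  by rewrite /s1 tmap_tens (F _ _ _ _ _ _ xp v1a v2b) id_lfunE tensZl.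
rewrite -/s1; move: s1 S1 => s1 S1.
apply: spanning_eq.
  apply: spanning_tens (spanning_tens3 gP gV gV) (spanning_homogeneous gV).
move=> _ [_ [v3 [[p [a [b [x [v1 [v2 [xp v1a v2b ->]]]]]]] [c v3c] ->]]].
rewrite !comp_lfunE.
have ab := object_twact a oV v2b; have ac := object_twact a oV v3c.
have bc := object_twact b oV v3c; have abc := object_twact a oV bc.
rewrite (S1 _ _ _ _ _ _ _ xp v1a v2b) (S2 _ _ _ _ _ _ _ _ xp v1a v2b v3c).
rewrite !lfunZ (S2 _ _ _ _ _ _ _ _ xp ab v1a v3c) (S1 _ _ _ _ _ _ _ xp v1a bc).
rewrite !lfunZ (S1 _ _ _ _ _ _ _ xp ab ac) (S2 _ _ _ _ _ _ _ _ xp abc v1a v2b).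
rewrite -[twact V (lconj a b) _](scalerK (omega_act_neq0 w (lconj a b) a c)).
rewrite (twact_swap a b oV v3c) !(tensZl, tensZr) !scalerA; congr (_ *: _).
apply: (mulIf (omega_act_neq0 w (lconj a b) a c)).
by rewrite -omega_braid_relation; field; rewrite omega_act_neq0.
Qed.

(** The Yang-Baxter relation for an empty prefix, where the braiding of the first
    two factors involves no associator. *)
Lemma braiding_relation V : is_object w V ->
  let s1 := tmap (braiding w V V) \1%VF in
  let s2 := braid_last w V V in
  (s1 \o (s2 \o s1) = s2 \o (s1 \o s2))%VF.
Proof.
move=> oV; have gV := object_graded oV.
pose f := braiding w V V.
have F a x y (xa : x \in degpart V a) : f (tens x y) = _ :=
  braiding_tens w y gV xa.
rewrite /= -/f; move: f F => f F.
pose s2 := braid_last w V V.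
have S2 a b c v1 v2 v3 (v1a : v1 \in degpart V a)
   (v2b : v2 \in degpart V b) (v3c : v3 \in degpart V c) :
   s2 (tens (tens v1 v2) v3) =
     omega_braid w a b c *: tens (tens v1 (twact V b v3)) v2 :=
  braid_last_tens gV oV v1a v2b v3c.
rewrite -/s2; move: s2 S2 => s2 S2.
pose s1 := tmap f (\1%VF : 'End(V)).
have S1 a v1 v2 v3 (v1a : v1 \in degpart V a) :
   s1 (tens (tens v1 v2) v3) = tens (tens (twact V a v2) v1) v3.
  by rewrite /s1 tmap_tens (F _ _ _ v1a) id_lfunE.
rewrite -/s1; move: s1 S1 => s1 S1.
apply: spanning_eq (spanning_tens3 gV gV gV) _.
move=> _ [a [b [c [v1 [v2 [v3 [v1a v2b v3c ->]]]]]]].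
rewrite !comp_lfunE.
have ab := object_twact a oV v2b; have ac := object_twact a oV v3c.
have bc := object_twact b oV v3c; have abc := object_twact a oV bc.
rewrite (S1 _ _ _ _ v1a) (S2 _ _ _ _ _ _ v1a v2b v3c).
rewrite (S2 _ _ _ _ _ _ ab v1a v3c) !lfunZ (S1 _ _ _ _ v1a) (S1 _ _ _ _ ab).
rewrite (S2 _ _ _ _ _ _ abc v1a v2b).
rewrite -[twact V (lconj a b) _](scalerK (omega_act_neq0 w (lconj a b) a c)).
rewrite (twact_swap a b oV v3c) !(tensZl, tensZr) !scalerA; congr (_ *: _).
apply: (mulIf (omega_act_neq0 w (lconj a b) a c)).
have := omega_braid_relation w 1%g a b c; rewrite !mul1g !omega_braid1 !mulr1 !mul1r.
by move=> <-; field; rewrite omega_act_neq0.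
Qed.

(** Braiding the last two factors commutes with degree-preserving operators on
    the others, since the associator only sees the degree of the prefix. *)
Lemma braid_last_far P V (f : 'End(P)) : graded P -> is_object w V ->
  (forall p x, x \in degpart P p -> f x \in degpart P p) ->
  let s := tmap (tmap f \1%VF) \1%VF in
  (s \o braid_last w P V = braid_last w P V \o s)%VF.
Proof.
move=> gP oV fdeg; have gV := object_graded oV.
pose s2 := braid_last w P V.
have S2 p a b x v u (xp : x \in degpart P p) (va : v \in degpart V a)
  (ub : u \in degpart V b) : s2 (tens (tens x v) u) = _ :=
  braid_last_tens gP oV xp va ub.
rewrite /= -/s2; move: s2 S2 => s2 S2.
pose s := tmap (tmap f (\1%VF : 'End(V))) (\1%VF : 'End(V)).
have S x v u : s (tens (tens x v) u) = tens (tens (f x) v) u.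
  by rewrite /s !tmap_tens !id_lfunE.
rewrite -/s; move: s S => s S.
apply: spanning_eq (spanning_tens3 gP gV gV) _.
move=> _ [p [a [b [x [v [u [xp va ub ->]]]]]]].
rewrite !comp_lfunE S (S2 _ _ _ _ _ _ xp va ub).
by rewrite (S2 _ _ _ _ _ _ (fdeg _ _ xp) va ub) lfunZ S.
Qed.

End BraidRelations.

(** * The action of the braid group on tensor powers *)

Section WordOperators.
Variables (K : fieldType) (U : vectType K) (n : nat) (s : 'I_n.-1 -> 'End(U)).

Definition letter_op (x : 'I_n.-1 * bool) : 'End(U) :=
  if x.2 then (s x.1)^-1%VF else s x.1.

Definition word_op (u : braid_word n) : 'End(U) :=
  foldr (fun x f => letter_op x \o f)%VF \1%VF u.

Lemma word_op_cat u v : word_op (u ++ v) = (word_op u \o word_op v)%VF.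
Proof. by elim: u => [|x u IH] /=; rewrite ?comp_lfun1l // IH comp_lfunA. Qed.

Hypothesis s_inj : forall i, lker (s i) == 0%VS.
Hypothesis s_far : forall i j : 'I_n.-1, (i.+1 < j)%N ->
  (s i \o s j = s j \o s i)%VF.
Hypothesis s_near : forall i j : 'I_n.-1, j = i.+1 :> nat ->
  (s i \o (s j \o s i) = s j \o (s i \o s j))%VF.

Lemma word_op_eq u v : braid_eq u v -> word_op u = word_op v.
Proof.
elim=> {u v} // [u v w _ -> _ -> //|u v u' v' _ IH _ IH'|[i b]|i j ij|i j ij].
- by rewrite !word_op_cat IH IH'.
- rewrite /= /letter_op comp_lfun1r; case: b => /=.
    exact: lker0_compVf.
  exact: lker0_compfV.
- by rewrite /= /letter_op /= !comp_lfun1r; apply: s_far.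
by rewrite /= /letter_op /= !comp_lfun1r; apply: s_near.
Qed.

Definition braid_op (b : braid_group n) : 'End(U) := word_op (braid_rep_word b).

Lemma braid_op_of u : braid_op (braid_of u) = word_op u.
Proof. by apply/word_op_eq/braid_ofP; rewrite braid_rep_wordK. Qed.

Lemma braid_op_gen i : braid_op (braid_gen i) = s i.
Proof. by rewrite braid_op_of /= comp_lfun1r. Qed.

Lemma braid_op_representation : representation fullv braid_op.
Proof.
split=> [a|u _|a b u _]; first exact: subvf.
  by rewrite braid_op_of id_lfunE.
by rewrite braid_op_of word_op_cat comp_lfunE.
Qed.

Lemma braid_op_ind (Q : 'End(U) -> Prop) :
  Q \1%VF -> (forall f g, Q f -> Q g -> Q (f \o g)%VF) ->
  (forall f, Q f -> Q f^-1%VF) -> (forall i, Q (s i)) ->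
  forall b, Q (braid_op b).
Proof.
move=> Q1 Qc Qv Qs b; rewrite /braid_op; elim: (braid_rep_word b) => //= x u.
by apply: Qc; rewrite /letter_op; case: x.2 => //; apply: Qv.
Qed.

End WordOperators.

Section TensorPowers.
Variables (R : realType) (G : finGroupType) (w : cocycle3 R G).
Variable V : graded_module R G.
Hypothesis oV : is_object w V.
Let gV : graded V := object_graded oV.

Lemma tpowerS_object m : is_object w (tpowerS w V m).
Proof. by elim: m => [|m IH] //=; apply: tensor_object. Qed.

Lemma tpowerS_graded m : graded (tpowerS w V m).
Proof. exact: object_graded (tpowerS_object m). Qed.

Lemma id_morphism (W : graded_module R G) : is_morphism (\1%VF : 'End(W)).
Proof.
by apply/is_morphismP; split=> [g v|g v]; rewrite !id_lfunE.
Qed.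

Lemma sigma_last_morphism m : is_morphism (sigma_last w V m).
Proof.
case: m => [|m]; first exact: braiding_morphism.
exact: braid_last_morphism (tpowerS_object m) oV.
Qed.

Lemma sigmaS_morphism m i : is_morphism (sigmaS w V m i).
Proof.
elim: m => [|m IH]; first exact: id_morphism.
rewrite /sigmaS -/(sigmaS w V m i); case: eqP => _.
  exact: sigma_last_morphism.
by apply: tmap_morphism (id_morphism V); rewrite //; apply: tpowerS_graded.
Qed.

Lemma sigmaS_onto m i : limg (sigmaS w V m i) = fullv.
Proof.
elim: m => [|m IH]; first exact: lim1g.
rewrite /sigmaS -/(sigmaS w V m i); case: eqP => _.
  case: m {IH} => [|m]; first exact: braiding_onto.
  exact: braid_last_onto (tpowerS_graded m) oV.
by apply: tmap_onto IH _; apply: lim1g.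
Qed.

Lemma sigmaS_lker0 m i : lker (sigmaS w V m i) == 0%VS.
Proof. exact: onto_lker0 (sigmaS_onto m i). Qed.

Lemma sigmaSS_last m : sigmaS w V m.+1 m = sigma_last w V m.
Proof. by rewrite /sigmaS eqxx. Qed.

Lemma sigmaSS m i : (i < m)%N ->
  sigmaS w V m.+1 i = tmap (sigmaS w V m i) (\1%VF : 'End(V)).
Proof. by move=> im; rewrite {1}/sigmaS -/(sigmaS w V m i) ltn_eqF. Qed.

Lemma sigmaS_far m i j : (i.+1 < j)%N -> (j < m)%N ->
  (sigmaS w V m i \o sigmaS w V m j = sigmaS w V m j \o sigmaS w V m i)%VF.
Proof.
move=> ij; elim: m => [|m IH] jm; first by exfalso; rewrite ltn0 in jm.
move: jm; rewrite ltnS leq_eqVlt => /orP[/eqP jm|jm].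
  move: ij; rewrite jm sigmaSS_last.
  case: m {IH jm} => [|m] im; first by exfalso; rewrite ltn0 in im.
  have /is_morphismP[fdeg _] := sigmaS_morphism m i.
  rewrite (sigmaSS (ltnW im)) (sigmaSS (im : (i < m)%N)).
  exact: braid_last_far (tpowerS_graded m) oV fdeg.
rewrite (sigmaSS jm) (sigmaSS (ltn_trans (ltnW ij) jm)).
exact: tmap_id_commute (IH jm).
Qed.

Lemma sigmaS_near m i : (i.+1 < m)%N ->
  (sigmaS w V m i \o (sigmaS w V m i.+1 \o sigmaS w V m i) =
   sigmaS w V m i.+1 \o (sigmaS w V m i \o sigmaS w V m i.+1))%VF.
Proof.
elim: m => [|m IH] jm; first by exfalso; rewrite ltn0 in jm.
move: jm; rewrite ltnS leq_eqVlt => /orP[/eqP jm|jm].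
  rewrite -jm sigmaSS_last sigmaSS // sigmaSS_last.
  case: i {IH jm} => [|i]; first exact: braiding_relation.
  exact: braid_last_relation (tpowerS_graded i) oV.
rewrite (sigmaSS jm) (sigmaSS (ltnW jm)).
exact: tmap_id_braid (IH jm).
Qed.

End TensorPowers.

(** * The lines of a tensor power *)

Lemma vline_scale (K : fieldType) (V : vectType K) (c : K) (v : V) :
  c != 0 -> (<[c *: v]> = <[v]>)%VS.
Proof.
move=> c0; apply/eqP; rewrite eqEsubv -!memvE memvZ ?memv_line //=.
by rewrite -[X in X \in _](scalerK c0) memvZ ?memv_line.
Qed.

Definition append_value (X : Type) (m : nat) (y : 'I_m.+1 -> X) (a : X) :
    'I_m.+2 -> X :=
  fun i => if unlift ord_max i is Some j then y j else a.

Lemma append_value_max X m (y : 'I_m.+1 -> X) a : append_value y a ord_max = a.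
Proof. by rewrite /append_value unlift_none. Qed.

Lemma append_value_widen X m (y : 'I_m.+1 -> X) a :
  (fun i : 'I_m.+1 => append_value y a (widen_ord (leqnSn m.+1) i)) = y.
Proof.
apply/funext => i; rewrite /append_value.
have -> : widen_ord (leqnSn m.+1) i = lift ord_max i.
  by apply: val_inj; rewrite /= /bump leqNgt ltn_ord.
by rewrite liftK.
Qed.

Lemma widen_max_ind m (P : 'I_m.+2 -> Prop) :
  (forall i : 'I_m.+1, P (widen_ord (leqnSn m.+1) i)) -> P ord_max ->
  forall i, P i.
Proof.
move=> Pw Pm i; case: (unliftP ord_max i) => [j ->|->] //.
have -> : lift ord_max j = widen_ord (leqnSn m.+1) j.
  by apply: val_inj; rewrite /= /bump leqNgt ltn_ord.
exact: Pw.
Qed.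

Section TensorLines.
Variables (R : realType) (G : finGroupType) (w : cocycle3 R G).
Variable V : monomial_YD w.
Let X := yd_index V.
Let oV : is_object w V := yd_object V.
Let gV : graded V := object_graded oV.
Notation L := (@yd_line R G w V).
Notation tl x := (tlineS w L x).

Lemma yd_line_vline a : exists2 u, u != 0 & L a = <[u]>%VS.
Proof. by apply: dim1_line; case: (yd_monomial V). Qed.

Lemma tlineS_append_value m (y : 'I_m.+1 -> X) a :
  tl (append_value y a) = tensv (tl y) (L a).
Proof. by rewrite /= append_value_max append_value_widen. Qed.

Lemma tlineS_vline m (x : 'I_m.+1 -> X) : exists2 v, v != 0 & tl x = <[v]>%VS.
Proof.
elim: m x => [|m IH] x; first exact: yd_line_vline.
have [v v0 tv] := IH (fun i => x (widen_ord (leqnSn m.+1) i)).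
have [u u0 Lu] := yd_line_vline (x ord_max).
by exists (tens v u); [exact: tens_neq0 | rewrite /= tv Lu tensv_line].
Qed.

Lemma dim_tlineS m (x : 'I_m.+1 -> X) : \dim (tl x) = 1%N.
Proof. by have [v v0 ->] := tlineS_vline x; rewrite dim_vline v0. Qed.

Lemma tlineS_degpart m (x : 'I_m.+1 -> X) :
  (tl x <= degpart (tpowerS w V m) (\prod_i yd_deg (x i))%g)%VS.
Proof.
elim: m x => [|m IH] x; first by rewrite big_ord1; apply: yd_homogeneous.
rewrite big_ord_recr; apply: tensv_subP => v u vx ux.
apply: tens_degpart; first by apply: subvP vx; apply: IH.
by apply: subvP ux; apply: yd_homogeneous.
Qed.

(** Appending an entry by [append_value] corresponds to a tensor product with one more
    line, and the tensor products of two decompositions form a decomposition. *)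
Lemma tlineS_direct m :
  directv (\sum_(t : m.+1.-tuple X) tl (tnth t)) /\
  (\sum_(t : m.+1.-tuple X) tl (tnth t))%VS = fullv.
Proof.
have [_ dL sL] := yd_monomial V.
elim: m => [|m [dm sm]].
  split.
    apply: (directv_sum_inj (h := fun t : 1.-tuple X => tnth t ord0)) dL.
    by move=> s t st; apply: eq_from_tnth => i; rewrite (ord1 i).
  apply/eqP; rewrite eqEsubv subvf -sL; apply/subv_sumP => x _.
  by apply: (sumv_sup [tuple x]) => //=; rewrite (tnth_nth x).
pose d (p : m.+1.-tuple X * X) := [tuple append_value (tnth p.1) p.2 i | i < m.+2].
have dE p : tl (tnth (d p)) = tensv (tl (tnth p.1)) (L p.2).
  by rewrite -tlineS_append_value; congr (tl _); apply/funext => i; rewrite tnth_mktuple.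
split.
  apply: (directv_sum_fibers (d := d)) (directv_tensv dm dL) => t.
  pose p := [tuple tnth t (widen_ord (leqnSn m.+1) i) | i < m.+1].
  have dp : d (p, tnth t ord_max) = t.
    apply: eq_from_tnth; apply: widen_max_ind => [i|]; rewrite tnth_mktuple.
      by have /(congr1 (@^~ i)) /= -> := append_value_widen (tnth p) (tnth t ord_max);
         rewrite tnth_mktuple.
    exact: append_value_max.
  apply: (sumv_sup (p, tnth t ord_max)); first exact/eqP.
  by rewrite -dE dp.
apply/eqP; rewrite eqEsubv subvf -(tensv_sum_full sm sL).
by apply/subv_sumP => p _; rewrite -dE (sumv_sup (d p)).
Qed.

Lemma tlineS_twact m g (x : 'I_m.+1 -> X) :
  exists y, (twact (tpowerS w V m) g @: tl x)%VS = tl y.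
Proof.
elim: m x => [|m IH] x.
  by have [y yx] := yd_permutes g (x ord0); exists (fun=> y).
pose x' i := x (widen_ord (leqnSn m.+1) i).
have -> : tl x = tensv (tl x') (L (x ord_max)) by [].
have := tlineS_degpart x'; have [y] := IH x'; have [v v0 ->] := tlineS_vline x'.
have [b] := yd_permutes g (x ord_max); have := yd_homogeneous (x ord_max).
have [u u0 ->] := yd_line_vline (x ord_max).
rewrite !limg_line -!memvE => ux gu gv vx; exists (append_value y b).
rewrite tlineS_append_value -gu -gv !tensv_line limg_line.
rewrite (twact_tens w g (tpowerS_graded oV m) gV vx ux) vline_scale //.
exact: omega_tens_neq0.
Qed.

Lemma tlineS_sigma m i (x : 'I_m.+1 -> X) :
  exists y, (sigmaS w V m i @: tl x)%VS = tl y.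
Proof.
elim: m x => [|m IH] x; first by exists x; rewrite lim1g.
pose x' k := x (widen_ord (leqnSn m.+1) k).
have -> : tl x = tensv (tl x') (L (x ord_max)) by [].
have [u u0 Lu] := yd_line_vline (x ord_max).
have ux : u \in degpart V (yd_deg (x ord_max)).
  by rewrite memvE -Lu yd_homogeneous.
rewrite /sigmaS -/(sigmaS w V m i); case: eqP => _; last first.
  have [v v0 tv] := tlineS_vline x'; have [y] := IH x'; rewrite tv limg_line => yE.
  exists (append_value y (x ord_max)).
  by rewrite tlineS_append_value -yE Lu !tensv_line limg_line tmap_tens id_lfunE.
case: m IH x x' u u0 Lu ux => [_|m _] x x' u u0 Lu ux.
  have [v v0 Lv] := yd_line_vline (x' ord0).
  have vx : v \in degpart V (yd_deg (x' ord0)).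
    by rewrite memvE -Lv yd_homogeneous.
  have [b Lb] := yd_permutes (yd_deg (x' ord0)) (x ord_max).
  exists (append_value (fun=> b) (x' ord0)); rewrite tlineS_append_value /= -Lb Lu Lv.
  by rewrite limg_line !tensv_line limg_line (braiding_tens w u gV vx).
pose x'' k := x' (widen_ord (leqnSn m.+1) k).
have -> : tl x' = tensv (tl x'') (L (x' ord_max)) by [].
have [v v0 Lv] := yd_line_vline (x' ord_max).
have vx : v \in degpart V (yd_deg (x' ord_max)).
  by rewrite memvE -Lv yd_homogeneous.
have [b Lb] := yd_permutes (yd_deg (x' ord_max)) (x ord_max).
have [t t0 tt] := tlineS_vline x''; have := tlineS_degpart x''.
rewrite tt -memvE => tx.
exists (append_value (append_value x'' b) (x' ord_max)).
rewrite !tlineS_append_value -Lb Lu Lv tt.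
rewrite limg_line !tensv_line limg_line.
have := braid_last_tens (tpowerS_graded oV m) oV tx vx ux.
by move=> E; rewrite [X in (<[X]>)%VS]E vline_scale // omega_braid_neq0.
Qed.

End TensorLines.

(** * Morphisms from the unit object and their braiding *)

Section HomFromUnit.
Variables (R : realType) (G : finGroupType) (W : graded_module R G).
Local Notation I := (unit_module R G).

Lemma point_linear (v : W) : linear (fun c : R[i]^o => c *: v).
Proof. by move=> k a b; rewrite scalerDl scalerA. Qed.

Definition point (v : W) : 'Hom(I, W) :=
  linfun (HB.pack_for {linear R[i]^o -> W} (fun c : R[i]^o => c *: v)
    (GRing.isLinear.Build _ _ _ _ (fun c : R[i]^o => c *: v) (point_linear v))).

Lemma pointE v (c : R[i]^o) : point v c = c *: v.
Proof. by rewrite lfunE. Qed.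

Lemma point_of_linear : linear point.
Proof.
move=> k u v; apply/lfunP => c; rewrite add_lfunE scale_lfunE !pointE.
by rewrite scalerDr !scalerA mulrC.
Qed.

Definition point_lfun : 'Hom(W, 'Hom(I, W)) :=
  linfun (HB.pack_for {linear W -> 'Hom(I, W)} point
    (GRing.isLinear.Build _ _ _ _ point point_of_linear)).

Lemma point_lfunE v : point_lfun v = point v.
Proof. by rewrite lfunE. Qed.

Lemma point_eval (f : 'Hom(I, W)) : f = point (f (1 : R[i]^o)).
Proof.
by apply/lfunP => c; rewrite pointE -lfunZ; congr (f _); rewrite /GRing.scale /= mulr1.
Qed.

Lemma point_lfun_lker0 : lker point_lfun == 0%VS.
Proof.
apply/lker0P => u v; rewrite !point_lfunE => /lfunP/(_ (1 : R[i]^o)).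
by rewrite !pointE !scale1r.
Qed.

Lemma postcomp_point (s : 'End(W)) v : postcomp I s (point v) = point (s v).
Proof.
have lin_s : linear (fun f : 'Hom(I, W) => (s \o f)%VF).
  by move=> k f g; rewrite comp_lfunDr comp_lfunZr.
pose S : {linear 'Hom(I, W) -> 'Hom(I, W)} :=
  HB.pack (fun f : 'Hom(I, W) => (s \o f)%VF)
    (GRing.isLinear.Build _ _ _ _ (fun f : 'Hom(I, W) => (s \o f)%VF) lin_s).
rewrite /postcomp (lfunE S); apply/lfunP => c.
by rewrite comp_lfunE !pointE lfunZ.
Qed.

(** The twisted action on the unit object is trivial and its degree is [1], so the
    value at [1] of a morphism is invariant of degree [1]. *)
Lemma Hom_unit : Hom_Z I W = (point_lfun @: invariants (twact W) (degpart W 1%g))%VS.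
Proof.
apply/vspaceP => f; rewrite Hom_ZP; apply/is_morphismP/memv_imgP.
  move=> [fdeg fact]; exists (f (1 : R[i]^o)); last by rewrite point_lfunE -point_eval.
  apply/invariantsP; split=> [|g]; first by apply: fdeg; rewrite /= eqxx memvf.
  by rewrite -fact /= id_lfunE.
move=> [v /invariantsP[v1 vinv] ->]; rewrite point_lfunE; split=> g c; last first.
  by rewrite /= id_lfunE pointE lfunZ vinv.
rewrite /= pointE; case: eqP => [-> _|_]; first exact: memvZ.
by rewrite memv0 => /eqP ->; rewrite scale0r mem0v.
Qed.

End HomFromUnit.

Lemma monomial_space_img (K : fieldType) (V W : vectType K) (f : 'Hom(V, W))
    (U : {vspace V}) (X : finType) (L : X -> {vspace V}) :
  lker f == 0%VS -> monomial_space U L ->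
  monomial_space (f @: U) (fun x => f @: L x)%VS.
Proof.
move=> f0 [dimL dirL sumL]; split=> [x||].
- by rewrite limg_dim_eq // (eqP f0) capv0.
- apply/directv_sum_independent => us usL us0 x _.
  have ex_vs y : exists v, v \in L y /\ us y = f v.
    by have /memv_imgP[v vL ->] := usL y isT; exists v.
  have [vs vsP] := choice ex_vs.
  rewrite (vsP x).2 (directv_sum_independent dirL vs) ?linear0 //.
    by move=> y _; have [] := vsP y.
  have /lker0P finj := f0; apply: finj; rewrite linear0 -[RHS]us0 linear_sum.
  by apply: eq_bigr => y _; rewrite (vsP y).2.
by rewrite -limg_sum sumL.
Qed.

Section MonomialBraiding.
Variables (R : realType) (G : finGroupType) (w : cocycle3 R G).
Variables (V : monomial_YD w) (m : nat).
Let oV : is_object w V := yd_object V.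
Local Notation W := (tpowerS w V m).
Local Notation N := (neutral_line V m.+1).
Let oW : is_object w W := tpowerS_object oV m.
Let gW : graded W := object_graded oW.

Lemma degpart_uniq (g h : G) (v : W) :
  v != 0 -> v \in degpart W g -> v \in degpart W h -> g = h.
Proof.
move=> v0 vg vh; apply/eqP; apply: contraNT v0 => /negPf gh.
have := homproj_degpart h gW vg; rewrite (homproj_degpart h gW vh) eqxx.
by rewrite eq_sym gh => ->.
Qed.

(** A line of degree [1] has a neutral index, since a nonzero vector has only one
    degree. So operators preserving degrees permute the lines of degree [1] as
    soon as they permute all the lines. *)
Lemma neutral_tuple_sub (x : 'I_m.+1 -> yd_index V) :
  (tlineS w (@yd_line R G w V) x <= degpart W 1%g)%VS ->
  exists t : neutral_tuple V m.+1, N t = tlineS w (@yd_line R G w V) x.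
Proof.
move=> x1; have [v v0 xv] := tlineS_vline x.
have xdeg := tlineS_degpart x; rewrite xv -!memvE in xdeg x1.
have tx : tnth (mktuple x) = x by apply/funext => i; rewrite tnth_mktuple.
have deg1 : (\prod_(i < m.+1) yd_deg (tnth (mktuple x) i))%g == 1%g.
  by rewrite tx; apply/eqP; apply: degpart_uniq v0 xdeg x1.
by exists (exist _ (mktuple x) deg1); rewrite /neutral_line /= tx.
Qed.

Lemma neutral_line_degpart (t : neutral_tuple V m.+1) : (N t <= degpart W 1%g)%VS.
Proof.
have := tlineS_degpart (tnth (val t)); by rewrite (eqP (valP t)).
Qed.

Lemma neutral_monomial : monomial_space (degpart W 1%g) N.
Proof.
have [dT sT] := tlineS_direct V m; split=> [t||].
- exact: dim_tlineS.
- exact: (directv_sum_inj (h := val) val_inj) dT.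
apply/eqP; rewrite eqEsubv; apply/andP; split.
  by apply/subv_sumP => t _; apply: neutral_line_degpart.
rewrite (component_sum_fiber _ (proj1 gW) sT (fun t => tlineS_degpart (tnth t))).
by apply/subv_sumP => t t1; apply: (sumv_sup (exist _ t t1)).
Qed.

Lemma neutral_representation : representation (degpart W 1%g) (twact W).
Proof.
have [_ W1 WM dW] := oW; split=> [g|v _|g h v v1]; last first.
- by rewrite (WM _ _ _ _ v1) omega_act1 scale1r.
- exact: W1.
by have := dW g 1%g; rewrite lconjg1.
Qed.

Lemma neutral_permutes (f : 'End(W)) :
  (f @: degpart W 1 <= degpart W 1)%VS ->
  (forall x, exists y, (f @: tlineS w (@yd_line R G w V) x)%VS
                       = tlineS w (@yd_line R G w V) y) ->
  forall t, exists t', (f @: N t)%VS = N t'.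
Proof.
move=> f1 fT t; have [y ty] := fT (tnth (val t)).
have [|t' t'y] := neutral_tuple_sub (x := y).
  by rewrite -ty; apply: subv_trans f1; apply/limgS/neutral_line_degpart.
by exists t'; rewrite t'y.
Qed.

Lemma neutral_twact : permutes_lines (twact W) N.
Proof.
move=> g; apply: (neutral_permutes _ (@tlineS_twact R G w V m g)).
by have [_ _ _ dW] := oW; have := dW g 1%g; rewrite lconjg1.
Qed.

Definition monomial_automorphism (f : 'End(W)) :=
  [/\ lker f == 0%VS, is_morphism f & forall t, exists t', (f @: N t)%VS = N t'].

Lemma monomial_automorphism1 : monomial_automorphism \1%VF.
Proof.
split; first by apply/lker0P => u v; rewrite !id_lfunE.
  exact: id_morphism.
by move=> t; exists t; rewrite lim1g.
Qed.

Lemma monomial_automorphism_comp f g : monomial_automorphism f ->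
  monomial_automorphism g -> monomial_automorphism (f \o g)%VF.
Proof.
move=> [f0 fM fN] [g0 gM gN]; split.
- have /lker0P finj := f0; have /lker0P ginj := g0.
  by apply/lker0P => u v; rewrite !comp_lfunE => /finj/ginj.
- have /is_morphismP[fd fc] := fM; have /is_morphismP[gd gc] := gM.
  apply/is_morphismP; split=> [a v va|a v]; rewrite !comp_lfunE ?gc ?fc //.
  by apply: fd; apply: gd.
move=> t; have [s gs] := gN t; have [r fr] := fN s.
by exists r; rewrite limg_comp gs fr.
Qed.

(** The induced map of the indices is injective, hence a permutation of a finite
    set, and the inverse operator induces the inverse permutation. *)
Lemma monomial_automorphism_inv f :
  monomial_automorphism f -> monomial_automorphism f^-1%VF.
Proof.
move=> [f0 fM fN]; have /is_morphismP[fd fc] := fM.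
have fK := lker0_lfunK f0; have fVK := lker0_lfunVK f0.
split.
- by apply/lker0P => u v /(congr1 f); rewrite !fVK.
- apply/is_morphismP; split=> [a v va|a v].
    have fa : (f @: degpart W a)%VS = degpart W a.
      apply/eqP; rewrite eqEdim limg_dim_eq ?(eqP f0) ?capv0 // leqnn andbT.
      by apply/subvP => _ /memv_imgP[u ua ->]; apply: fd.
    by move: va; rewrite -{1}fa => /memv_imgP[u ua ->]; rewrite fK.
  by apply: (can_inj fK); rewrite fc !fVK.
have [p pE] := choice fN.
have pinj : injective p.
  move=> s t st; apply: (line_inj neutral_monomial).
  by apply/eqP; rewrite -(eq_limg_ker0 _ _ f0) !pE st.
move=> t; exists (invF pinj t).
rewrite -[t in LHS](f_invF pinj) -pE -limg_comp lker0_compVf //.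
exact: lim1g.
Qed.

Lemma monomial_automorphism_sigma i : monomial_automorphism (sigmaS w V m i).
Proof.
have sM := sigmaS_morphism oV m i; split=> //; first exact: sigmaS_lker0.
apply: (neutral_permutes _ (@tlineS_sigma R G w V m i)).
have /is_morphismP[sd _] := sM.
by apply/subvP => _ /memv_imgP[u u1 ->]; apply: sd.
Qed.

Definition braid_action (b : braid_group m.+1) : 'End(W) :=
  braid_op (fun i : 'I_m.+1.-1 => sigmaS w V m i) b.

Lemma braid_action_automorphism b : monomial_automorphism (braid_action b).
Proof.
apply: braid_op_ind.
- exact: monomial_automorphism1.
- exact: monomial_automorphism_comp.
- exact: monomial_automorphism_inv.
by move=> i; apply: monomial_automorphism_sigma.
Qed.

Lemma sigmaS_relations :
  [/\ forall i : 'I_m, lker (sigmaS w V m i) == 0%VS,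
      forall i j : 'I_m, (i.+1 < j)%N ->
        (sigmaS w V m i \o sigmaS w V m j = sigmaS w V m j \o sigmaS w V m i)%VF
    & forall i j : 'I_m, j = i.+1 :> nat ->
        (sigmaS w V m i \o (sigmaS w V m j \o sigmaS w V m i) =
         sigmaS w V m j \o (sigmaS w V m i \o sigmaS w V m j))%VF].
Proof.
split=> [i|i j ij|i j ij]; first exact: sigmaS_lker0.
  exact: sigmaS_far.
by rewrite ij; apply: sigmaS_near; rewrite // -ij.
Qed.

Lemma braid_action_representation : representation fullv braid_action.
Proof. by have [s0 sf sn] := sigmaS_relations; apply: braid_op_representation. Qed.

Lemma braid_action_gen (i : 'I_m.+1.-1) :
  braid_action (braid_gen i) = sigmaS w V m i.
Proof. by have [s0 sf sn] := sigmaS_relations; apply: braid_op_gen. Qed.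

Lemma complex_natr_neq0 k : k.+1%:R != 0 :> R[i].
Proof. by rewrite Num.Theory.pnatr_eq0. Qed.

Let inv_monomial := invariants_monomial complex_natr_neq0 neutral_monomial
  neutral_representation neutral_twact.

Definition hom_line (O : regular_orbit (twact W) N) :
    {vspace 'Hom(unit_module R G, W)} :=
  (point_lfun W @: orbit_line O)%VS.

Lemma hom_monomial : monomial_space (Hom_Z (unit_module R G) W) hom_line.
Proof.
by rewrite Hom_unit; apply: monomial_space_img inv_monomial; apply: point_lfun_lker0.
Qed.

Lemma dim_Hom : \dim (Hom_Z (unit_module R G) W) = #|regular_orbits (twact W) N|.
Proof.
rewrite Hom_unit limg_dim_eq ?(eqP (point_lfun_lker0 W)) ?capv0 //.
exact: (dim_invariants complex_natr_neq0 neutral_monomial neutral_representation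
  neutral_twact).
Qed.

Lemma postcomp_point_lfun (s : 'End(W)) v :
  postcomp (unit_module R G) s (point_lfun W v) = point_lfun W (s v).
Proof. by rewrite !point_lfunE postcomp_point. Qed.

Lemma hom_representation : representation (Hom_Z (unit_module R G) W)
  (fun b => postcomp (unit_module R G) (braid_action b)).
Proof.
have [_ rho1 rhoM] := braid_action_representation.
rewrite Hom_unit; split=> [b|f|a b f].
- have [_ /is_morphismP[bd bc] _] := braid_action_automorphism b.
  apply/subvP => _ /memv_imgP[f /memv_imgP[v /invariantsP[v1 vinv] ->] ->].
  rewrite postcomp_point_lfun memv_img //; apply/invariantsP.
  by split=> [|g]; [apply: bd | rewrite -bc vinv].
- by move=> /memv_imgP[v _ ->]; rewrite postcomp_point_lfun rho1 ?memvf.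
by move=> /memv_imgP[v _ ->]; rewrite !postcomp_point_lfun rhoM ?memvf.
Qed.

Lemma hom_permutes :
  permutes_lines (fun b => postcomp (unit_module R G) (braid_action b)) hom_line.
Proof.
move=> b O; have [b0 /is_morphismP[_ bc] bN] := braid_action_automorphism b.
have [|O' OO'] := commuting_permutes_orbit_lines complex_natr_neq0 neutral_monomial
  neutral_representation neutral_twact b0 _ bN O.
  by move=> g v _; apply: bc.
exists O'; rewrite /hom_line -OO' -!limg_comp; apply: eq_in_limg => v _.
by rewrite !comp_lfunE postcomp_point_lfun.
Qed.

End MonomialBraiding.

Theorem theorem3p3 (R : realType) (G : finGroupType) (w : cocycle3 R G)
    (n : nat) (hn : (1 <= n)%N) (V : monomial_YD w) :
  (exists rho : braid_group n -> 'End(tpower w V n),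
     [/\ representation fullv rho,
         forall i : 'I_n.-1, rho (braid_gen i) = sigma w V n i
       & exists (Y : finType)
                (L : Y -> {vspace 'Hom(unit_module R G, tpower w V n)}),
           monomial_representation (Hom_Z (unit_module R G) (tpower w V n))
             (fun b => postcomp (unit_module R G) (rho b)) L])
  /\
  \dim (Hom_Z (unit_module R G) (tpower w V n)) =
    #|regular_orbits (twact (tpower w V n)) (neutral_line V n)|.
Proof.
case: n hn => // m _; split; last exact: dim_Hom.
exists (@braid_action R G w V m); split.
- exact: braid_action_representation.
- exact: braid_action_gen.
exists (regular_orbit (twact (tpowerS w V m)) (neutral_line V m.+1)).
exists (@hom_line R G w V m); split.
- exact: hom_monomial.
- exact: hom_representation.
exact: hom_permutes.
Qed.
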